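(* Let $G$ be an infinite discrete weakly cancellative right cancellative semigroup. Then: (1) the first topological centre of $\ell^1(G)^{**}$ is $\ell^1(G)$; (2) the first topological centre of $c_0(G)^\perp$ is $\{0\}$; (3) the first topological centre of $\beta G$ is $G$; (4) the first topological centre of $G^*$ is empty.
   Context: A semigroup $G$ is weakly cancellative if $\{u:su=t\}$ and $\{u:us=t\}$ are finite for all $s,t\in G$; right cancellative if $\{u:us=t\}$ has at most one element for all $s,t$. $\ell^1(G)$ is the semigroup algebra under convolution and $\ell^1(G)^{**}=\ell^\infty(G)^*$ carries the first Arens product: with $A=\ell^1(G)$, $\langle S\cdot a,b\rangle=\langle S,ab\rangle$, $\langle\Psi\cdot S,a\rangle=\langle\Psi,S\cdot a\rangle$, $\langle\Phi\Psi,S\rangle=\langle\Phi,\Psi\cdot S\rangle$ ($a,b\in A$, $S\in A^*$, $\Phi,\Psi\in A^{**}$). $c_0(G)^\perp$ is the annihilator of $c_0(G)$ in $\ell^\infty(G)^*$. $\beta G$, the Stone–Čech compactification of $G$, is the spectrum of $\ell^\infty(G)$, a compact subsemigroup of $\ell^\infty(G)^*$ containing $G$ via point evaluations, and $G^*=\beta G\setminus G$. For a subsemigroup or subalgebra $\mathscr S$ of $\ell^1(G)^{**}$, the first topological centre is the set of $\Psi\in\mathscr S$ such that $\Phi\mapsto\Psi\Phi$, $\mathscr S\to\mathscr S$, is weak$^*$-weak$^*$-continuous. *)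

(* Defs.v *)
From HB Require Import structures.
From mathcomp Require Import all_boot all_order all_algebra.
From mathcomp Require Import complex.
From mathcomp Require Import all_classical all_reals all_analysis.

Set Implicit Arguments.
Unset Strict Implicit.
Unset Printing Implicit Defensive.
Import Order.TTheory GRing.Theory Num.Theory.
Import numFieldNormedType.Exports.
Import ComplexField.

Local Open Scope classical_set_scope.
Local Open Scope ring_scope.

Notation normc := Normc.normc.

Section ESum.
Context {R : realType}.
Local Open Scope ereal_scope.

Lemma esumZ (I : choiceType) (D : set I) (c : R) (a : I -> \bar R) :
  (0 <= c)%R -> (forall i, 0 <= a i) ->
  \esum_(i in D) (c%:E * a i) = c%:E * \esum_(i in D) a i.
Proof.
move=> c0 a0.
have le (k : R) (b : I -> \bar R) : (0 <= k)%R -> (forall i, 0 <= b i) ->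
    \esum_(i in D) (k%:E * b i) <= k%:E * \esum_(i in D) b i.
  move=> k0 b0; apply: ge_ereal_sup => _ [X DX <-].
  rewrite -ge0_mule_fsumr//; apply: lee_wpmul2l; first by rewrite lee_fin.
  by apply: ereal_sup_ubound; exists X.
apply/eqP; rewrite eq_le le//=.
have [->|cN0] := eqVneq c 0%R.
  by rewrite mul0e; apply: esum_ge0 => i _; rewrite mul0e.
have cV : (0 <= c^-1)%R by rewrite invr_ge0.
have c0E : 0 <= c%:E by rewrite lee_fin.
have H := le (c^-1)%R (fun i => c%:E * a i) cV (fun i => mule_ge0 c0E (a0 i)).
have {H} : \esum_(i in D) a i <= c^-1%:E * \esum_(i in D) (c%:E * a i).
  apply: le_trans H; apply: le_esum => i _.
  by rewrite muleA -EFinM mulVf// mul1e.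
move=> /(lee_wpmul2l c0E); rewrite muleA -EFinM mulfV// mul1e; exact.
Qed.

Lemma esum_exchange (I J : choiceType) (a : I -> J -> \bar R) :
  (forall i j, 0 <= a i j) ->
  \esum_(i in [set: I]) \esum_(j in [set: J]) a i j =
  \esum_(j in [set: J]) \esum_(i in [set: I]) a i j.
Proof.
move=> a0; rewrite !esum_esum//.
rewrite (@reindex_esum _ _ _ ([set: J] `*`` (fun=> [set: I])) _
  (fun p => (p.2, p.1)))//.
split => //=; first by move=> [x y] [x' y'] _ _ [-> ->].
by move=> [x y] _; exists (y, x).
Qed.

End ESum.

Section Sums.
Context {R : realType}.

(* For an absolutely summable family these are the unconditional sums; the index
   set may be uncountable. On other families the value is meaningless, and
   every use below comes with a proof of absolute summability. *)
Definition rsum (I : choiceType) (u : I -> R) : R :=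
  fine (\esum_(i in [set: I]) (EFin \o u)^\+ i)%E -
  fine (\esum_(i in [set: I]) (EFin \o u)^\- i)%E.

Definition csum (I : choiceType) (u : I -> R[i]) : R[i] :=
  (rsum (fun i => complex.Re (u i)) +i* rsum (fun i => complex.Im (u i)))%C.

Definition abs_summable (I : choiceType) (u : I -> R[i]) : Prop :=
  (\esum_(i in [set: I]) (normc (u i))%:E < +oo)%E.

End Sums.

Section RSum.
Context {R : realType} {I : choiceType}.
Implicit Types (u v p q : I -> R).

Let S (p : I -> R) : \bar R := (\esum_(i in [set: I]) (p i)%:E)%E.

Lemma esum_fin p : (forall i, 0 <= p i) -> (S p < +oo)%E -> S p \is a fin_num.
Proof.
by move=> p0 ?; rewrite ge0_fin_numE//; apply: esum_ge0 => i _; rewrite lee_fin.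
Qed.

Lemma le_esum_lty (a b : I -> \bar R) : (forall i, a i <= b i)%E ->
  (\esum_(i in [set: I]) b i < +oo)%E -> (\esum_(i in [set: I]) a i < +oo)%E.
Proof. by move=> ab; apply: le_lt_trans; apply: le_esum => i _. Qed.

Lemma rsum_diff p q : (forall i, 0 <= p i) -> (forall i, 0 <= q i) ->
  (S p < +oo)%E -> (S q < +oo)%E ->
  rsum (fun i => p i - q i) = fine (S p) - fine (S q).
Proof.
move=> p0 q0 Sp Sq.
pose u i := p i - q i.
have ple i : ((EFin \o u)^\+ i <= (p i)%:E)%E.
  by rewrite funeposE ge_max !lee_fin p0 andbT gerBl q0.
have qle i : ((EFin \o u)^\- i <= (q i)%:E)%E.
  by rewrite funenegE ge_max -EFinN !lee_fin q0 andbT opprB gerBl p0.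
have summ (f : I -> R) : (forall i, 0 <= f i) -> (S f < +oo)%E ->
    summable [set: I] (EFin \o f).
  by move=> f0 Sf; apply: le_lt_trans Sf; apply: le_esum => i _ /=; rewrite ger0_norm.
have := @esumB R I setT (EFin \o p) (EFin \o q) (summ _ p0 Sp) (summ _ q0 Sq).
move=> /(_ (fun i _ => p0 i) (fun i _ => q0 i)).
rewrite -/(S p) -/(S q) => /(congr1 fine).
have -> : ((EFin \o p) \- (EFin \o q))%E = EFin \o u by apply/funext => i.
rewrite [in X in _ = X -> _]fineB ?esum_fin// fineB//.
- rewrite ge0_fin_numE; last by apply: esum_ge0 => i _; exact: funepos_ge0.
  exact: le_esum_lty ple Sp.
- rewrite ge0_fin_numE; last by apply: esum_ge0 => i _; exact: funeneg_ge0.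
  exact: le_esum_lty qle Sq.
Qed.

Definition rpos u i := Num.max (u i) 0.
Definition rneg u i := Num.max (- u i) 0.
Let rpos0 u i : 0 <= rpos u i. Proof. by rewrite le_max lexx orbT. Qed.
Let rneg0 u i : 0 <= rneg u i. Proof. by rewrite le_max lexx orbT. Qed.
Let rposneg u : u = fun i => rpos u i - rneg u i.
Proof.
apply/funext => i; rewrite /rpos /rneg; have [u0|u0] := leP 0 (u i).
  by rewrite max_r ?subr0// oppr_le0.
by rewrite max_l ?oppr_ge0 ?(ltW u0)// sub0r opprK.
Qed.
Let rpos_le u i : rpos u i <= `|u i|.
Proof. by rewrite ge_max normr_ge0 ler_norm. Qed.
Let rneg_le u i : rneg u i <= `|u i|.
Proof. by rewrite ge_max normr_ge0 -normrN ler_norm. Qed.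

Let N u : \bar R := (\esum_(i in [set: I]) `|u i|%:E)%E.

Let Spos u : (N u < +oo)%E -> (S (rpos u) < +oo)%E.
Proof. by apply: le_esum_lty => i; rewrite lee_fin rpos_le. Qed.
Let Sneg u : (N u < +oo)%E -> (S (rneg u) < +oo)%E.
Proof. by apply: le_esum_lty => i; rewrite lee_fin rneg_le. Qed.
Let finpos u : (N u < +oo)%E -> S (rpos u) \is a fin_num.
Proof. by move=> Nu; apply: esum_fin => //; exact: Spos. Qed.
Let finneg u : (N u < +oo)%E -> S (rneg u) \is a fin_num.
Proof. by move=> Nu; apply: esum_fin => //; exact: Sneg. Qed.
Let SD p q : (forall i, 0 <= p i) -> (forall i, 0 <= q i) ->
  S (fun i => p i + q i) = (S p + S q)%E.
Proof. by move=> p0 q0; rewrite /S -esumD// => i _; rewrite lee_fin. Qed.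
Let SZ c p : 0 <= c -> (forall i, 0 <= p i) ->
  S (fun i => c * p i) = (c%:E * S p)%E.
Proof. by move=> c0 p0; rewrite /S -esumZ// => i; rewrite lee_fin. Qed.

Lemma rsumE u : (N u < +oo)%E -> rsum u = fine (S (rpos u)) - fine (S (rneg u)).
Proof.
move=> Nu; rewrite [in LHS](rposneg u).
by apply: rsum_diff => //; [exact: Spos|exact: Sneg].
Qed.

Lemma rsumD u v : (N u < +oo)%E -> (N v < +oo)%E ->
  rsum (fun i => u i + v i) = rsum u + rsum v.
Proof.
move=> Nu Nv; rewrite (rsumE Nu) (rsumE Nv).
have -> : (fun i => u i + v i) =
    fun i => (rpos u i + rpos v i) - (rneg u i + rneg v i).
  by apply/funext => i; rewrite [in LHS](rposneg u) [in LHS](rposneg v) opprD addrACA.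
have D0 (f g : I -> R) : (forall i, 0 <= f i) -> (forall i, 0 <= g i) ->
    forall i, 0 <= f i + g i by move=> f0 g0 i; rewrite addr_ge0.
rewrite rsum_diff; [|exact: D0|exact: D0|by rewrite SD// lte_add_pinfty ?Spos
  |by rewrite SD// lte_add_pinfty ?Sneg].
rewrite !SD//.
rewrite (fineD (finpos Nu) (finpos Nv)) (fineD (finneg Nu) (finneg Nv)).
by rewrite opprD addrACA.
Qed.

Lemma rsumN u : (N u < +oo)%E -> rsum (fun i => - u i) = - rsum u.
Proof.
move=> Nu; rewrite (rsumE Nu) opprB.
have -> : (fun i => - u i) = fun i => rneg u i - rpos u i.
  by apply/funext => i; rewrite [in LHS](rposneg u) opprB.
by apply: rsum_diff => //; [exact: Sneg|exact: Spos].
Qed.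

Let rsumZ_ge0 c u : 0 <= c -> (N u < +oo)%E ->
  rsum (fun i => c * u i) = c * rsum u.
Proof.
move=> c0 Nu; rewrite (rsumE Nu).
have -> : (fun i => c * u i) = fun i => c * rpos u i - c * rneg u i.
  by apply/funext => i; rewrite [in LHS](rposneg u) mulrBr.
have fp := finpos Nu.
have fn := finneg Nu.
rewrite rsum_diff ?SZ//.
- by rewrite !fineM// mulrBr.
- by move=> i; rewrite mulr_ge0.
- by move=> i; rewrite mulr_ge0.
- by rewrite ltey_eq fin_numM.
- by rewrite ltey_eq fin_numM.
Qed.

Lemma rsumZ c u : (N u < +oo)%E -> rsum (fun i => c * u i) = c * rsum u.
Proof.
move=> Nu; have [c0|c0] := leP 0 c; first exact: rsumZ_ge0.
have -> : (fun i => c * u i) = fun i => (- c) * (- u i).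
  by apply/funext => i; rewrite mulrNN.
rewrite rsumZ_ge0 ?oppr_ge0 ?(ltW c0)// ?rsumN ?mulrNN//.
by apply: le_esum_lty Nu => i; rewrite normrN.
Qed.

Lemma ler_norm_rsum u : (N u < +oo)%E -> `|rsum u| <= fine (N u).
Proof.
move=> Nu; rewrite (rsumE Nu).
have fp := finpos Nu.
have fn := finneg Nu.
have N0 : N u \is a fin_num by rewrite esum_fin.
have pos : 0 <= fine (S (rpos u)).
  by rewrite fine_ge0// esum_ge0// => i _; rewrite lee_fin.
have neg : 0 <= fine (S (rneg u)).
  by rewrite fine_ge0// esum_ge0// => i _; rewrite lee_fin.
have lep : fine (S (rpos u)) <= fine (N u).
  by rewrite fine_le//; apply: le_esum => i _; rewrite lee_fin.
have len : fine (S (rneg u)) <= fine (N u).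
  by rewrite fine_le//; apply: le_esum => i _; rewrite lee_fin.
by rewrite ler_norml lerBrDr lerBlDr; apply/andP; split;
  [rewrite (le_trans _ pos)// addrC subr_le0|rewrite (le_trans lep)// lerDl].
Qed.

Lemma esum_supp1 (a : I -> \bar R) t : (0 <= a t)%E ->
  (forall i, i != t -> a i = 0%E) -> (\esum_(i in [set: I]) a i)%E = a t.
Proof.
move=> a0 az; rewrite -(esum_set1 a0) [RHS]esum_mkcond; apply: eq_esum => i _.
by case: ifPn => //; rewrite notin_setE => /eqP/az.
Qed.

Lemma rsum_supp1 u t : (forall i, i != t -> u i = 0) -> rsum u = u t.
Proof.
move=> u0.
have Nu : (N u < +oo)%E.
  by rewrite /N (@esum_supp1 _ t) ?ltry// => i /u0->; rewrite normr0.
rewrite (rsumE Nu) /S (@esum_supp1 _ t) ?lee_fin// ?(@esum_supp1 _ t) ?lee_fin//.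
- by move/(congr1 (@^~ t)): (rposneg u) => /= ->.
- by move=> i /u0 ui; rewrite /rneg ui oppr0 maxxx.
- by move=> i /u0 ui; rewrite /rpos ui maxxx.
Qed.

End RSum.

Section CSum.
Context {R : realType} {I : choiceType}.
Implicit Types (u v : I -> R[i]).

Let N u : \bar R := (\esum_(i in [set: I]) (normc (u i))%:E)%E.

Lemma normc_ge0 (z : R[i]) : 0 <= normc z.
Proof. by case: z => x y; rewrite sqrtr_ge0. Qed.

Lemma normcEC (z : R[i]) : `|z| = (normc z)%:C%C.
Proof. by case: z. Qed.

Lemma le_normcC (z : R[i]) (c : R) : (`|z| <= c%:C%C) = (normc z <= c).
Proof. by rewrite normcEC lecR. Qed.

Lemma normcD (z w : R[i]) : normc (z + w) <= normc z + normc w.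
Proof. by rewrite le_normcD. Qed.

Lemma Re_le_normc (z : R[i]) : `|complex.Re z| <= normc z.
Proof. by rewrite -lecR -normcEC normc_ge_Re. Qed.

Lemma Im_le_normc (z : R[i]) : `|complex.Im z| <= normc z.
Proof.
by case: z => x y /=; rewrite -sqrtr_sqr ler_wsqrtr// lerDr sqr_ge0.
Qed.

Lemma abs_summable_Re u : abs_summable u ->
  (\esum_(i in [set: I]) `|complex.Re (u i)|%:E < +oo)%E.
Proof. by apply: le_esum_lty => i; rewrite lee_fin Re_le_normc. Qed.

Lemma abs_summable_Im u : abs_summable u ->
  (\esum_(i in [set: I]) `|complex.Im (u i)|%:E < +oo)%E.
Proof. by apply: le_esum_lty => i; rewrite lee_fin Im_le_normc. Qed.

Lemma abs_summable_fin u : abs_summable u -> N u \is a fin_num.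
Proof. by move=> Nu; apply: esum_fin => // i; exact: normc_ge0. Qed.

Lemma abs_summable_le u v : (forall i, normc (u i) <= normc (v i)) ->
  abs_summable v -> abs_summable u.
Proof. by move=> uv; apply: le_esum_lty => i; rewrite lee_fin. Qed.

Lemma abs_summableD u v : abs_summable u -> abs_summable v ->
  abs_summable (fun i => u i + v i).
Proof.
move=> Nu Nv.
apply: (@le_esum_lty _ _ _ (fun i => (normc (u i))%:E + (normc (v i))%:E)%E).
  by move=> i; rewrite -EFinD lee_fin normcD.
rewrite esumD ?lte_add_pinfty// => i _; rewrite lee_fin normc_ge0//.
Qed.

Lemma esum_normcZ (c : R[i]) u :
  (\esum_(i in [set: I]) (normc (c * u i)%R)%:E = (normc c)%:E * N u)%E.
Proof.
rewrite -esumZ ?normc_ge0//; last by move=> i; rewrite lee_fin normc_ge0.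
by apply: eq_esum => i _; rewrite Normc.normcM.
Qed.

Lemma abs_summableZ (c : R[i]) u : abs_summable u ->
  abs_summable (fun i => c * u i).
Proof.
move=> Nu; rewrite /abs_summable esum_normcZ ltey_eq fin_numM//.
exact: abs_summable_fin.
Qed.

Lemma csumD u v : abs_summable u -> abs_summable v ->
  csum (fun i => u i + v i) = csum u + csum v.
Proof.
move=> Nu Nv.
have hRe := @rsumD R I (fun i => complex.Re (u i)) (fun i => complex.Re (v i))
  (abs_summable_Re Nu) (abs_summable_Re Nv).
have hIm := @rsumD R I (fun i => complex.Im (u i)) (fun i => complex.Im (v i))
  (abs_summable_Im Nu) (abs_summable_Im Nv).
transitivity (Complex (rsum (fun i => complex.Re (u i)) + rsum (fun i => complex.Re (v i)))
  (rsum (fun i => complex.Im (u i)) + rsum (fun i => complex.Im (v i)))); last by [].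
rewrite -{}hRe -{}hIm /csum; congr Complex; congr rsum; apply/funext => i;
  by case: (u i) (v i) => [? ?] [? ?].
Qed.

Lemma csumZ (c : R[i]) u : abs_summable u ->
  csum (fun i => c * u i) = c * csum u.
Proof.
move=> Nu; have NRe := abs_summable_Re Nu; have NIm := abs_summable_Im Nu.
have NZ k (w : I -> R) : (\esum_(i in [set: I]) `|w i|%:E < +oo)%E ->
    (\esum_(i in [set: I]) `|k * w i|%:E < +oo)%E.
  move=> Nw; rewrite (@eq_esum _ _ _ _ (fun i => `|k|%:E * `|w i|%:E)%E); last first.
    by move=> i _; rewrite normrM EFinM.
  by rewrite esumZ// ltey_eq fin_numM// esum_fin.
case: c => a b.
pose x i := complex.Re (u i); pose y i := complex.Im (u i).
have hRe := @rsumD R I (fun i => a * x i) (fun i => (- b) * y i)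
  (NZ a _ NRe) (NZ (- b) _ NIm).
have hIm := @rsumD R I (fun i => a * y i) (fun i => b * x i)
  (NZ a _ NIm) (NZ b _ NRe).
rewrite (@rsumZ R I a x NRe) (@rsumZ R I (- b) y NIm) mulNr in hRe.
rewrite (@rsumZ R I a y NIm) (@rsumZ R I b x NRe) in hIm.
transitivity (Complex (a * rsum x - b * rsum y) (a * rsum y + b * rsum x)); last by [].
rewrite -{}hRe -{}hIm /csum; congr Complex; congr rsum; apply/funext => i;
  by rewrite /x /y; case: (u i) => p q //=; rewrite mulNr.
Qed.

Lemma csum_supp1 u t : (forall i, i != t -> u i = 0) -> csum u = u t.
Proof.
move=> u0; rewrite /csum (@rsum_supp1 _ _ _ t) ?(@rsum_supp1 _ _ _ t).
- by case: (u t).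
- by move=> i /u0->.
- by move=> i /u0->.
Qed.

Lemma normc_csum u : abs_summable u -> normc (csum u) <= fine (N u).
Proof.
move=> Nu; have [z0|z0] := eqVneq (csum u) 0.
  rewrite z0 Normc.normc0 fine_ge0// esum_ge0// => i _.
  by rewrite lee_fin normc_ge0.
have nz0 : normc (csum u) != 0 by apply: contra z0 => /eqP/Normc.eq0_normc ->.
pose w := (normc (csum u))%:C%C / csum u.
have nw : normc w = 1.
  rewrite Normc.normcM Normc.normcV.
  have -> : normc (normc (csum u))%:C%C = normc (csum u).
    by rewrite /= expr0n addr0 sqrtr_sqr ger0_norm// normc_ge0.
  by rewrite divff.
have : csum (fun i => w * u i) = (normc (csum u))%:C%C.
  by rewrite csumZ// mulfVK.
move=> /(congr1 (@complex.Re R))/= <-.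
have Nw := abs_summable_Re (abs_summableZ w Nu).
rewrite (le_trans (ler_norm _))// (le_trans (ler_norm_rsum Nw))//.
apply: fine_le; [exact: esum_fin|exact: abs_summable_fin|].
apply: le_esum => i _; rewrite lee_fin (le_trans (Re_le_normc _))//.
by rewrite Normc.normcM nw mul1r.
Qed.

End CSum.

(* Functions take their values in [R[i]^o], the field $\mathbb C$ seen as a normed
   module over itself: [R[i]] alone does not carry that structure. *)
Section Ell1.
Context (R : realType) (G : choiceType).

Definition ell1_pred : {pred G -> R[i]^o} := fun a => `[< abs_summable a >].

Fact ell1_submod_closed : submod_closed ell1_pred.
Proof.
split=> [|c a b /asboolP Na /asboolP Nb]; apply/asboolP.
  rewrite /abs_summable (eq_esum (b := fun=> 0%E)) ?esum1//.
  by move=> i _; rewrite Normc.normc0.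
exact: (abs_summableD (abs_summableZ c Na) Nb).
Qed.

HB.instance Definition _ := GRing.isSubmodClosed.Build R[i] (G -> R[i]^o)
  ell1_pred ell1_submod_closed.

Record ell1 := Ell1 { ell1_fun :> G -> R[i]^o; _ : ell1_fun \in ell1_pred }.

HB.instance Definition _ := [isSub for ell1_fun].
HB.instance Definition _ := [Choice of ell1 by <:].
HB.instance Definition _ := [SubChoice_isSubLmodule of ell1 by <:].

Lemma ell1_summable (a : ell1) : abs_summable a.
Proof. by case: a => a aP; exact/asboolP. Qed.

Definition ell1_of (a : G -> R[i]^o) (sa : abs_summable a) : ell1 :=
  Ell1 (asboolT sa).

Definition norm1 (a : ell1) : R :=
  fine (\esum_(g in [set: G]) (normc (a g))%:E)%E.

Lemma norm1_fin (a : ell1) :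
  (\esum_(g in [set: G]) (normc (a g))%:E)%E = (norm1 a)%:E.
Proof. by rewrite fineK// abs_summable_fin//; exact: ell1_summable. Qed.

Lemma norm1_ge0 (a : ell1) : 0 <= norm1 a.
Proof.
by rewrite fine_ge0// esum_ge0// => g _; rewrite lee_fin normc_ge0.
Qed.

Lemma normc_le_norm1 (a : ell1) g : normc (a g) <= norm1 a.
Proof.
rewrite -lee_fin -norm1_fin -(@esum_set1 _ _ g (fun g => (normc (a g))%:E)).
  by rewrite [leLHS]esum_mkcond; apply: le_esum => i _; case: ifP => // _;
    rewrite lee_fin normc_ge0.
by rewrite lee_fin normc_ge0.
Qed.

Let ell1_norm (a : ell1) : R[i] := (norm1 a)%:C%C.

Lemma ell1DE (a b : ell1) g : (a + b) g = a g + b g. Proof. by []. Qed.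
Lemma ell1ZE (c : R[i]) (a : ell1) g : (c *: a) g = c * a g.
Proof. by []. Qed.

Fact ell1_normD (a b : ell1) : ell1_norm (a + b) <= ell1_norm a + ell1_norm b.
Proof.
rewrite -rmorphD lecR -lee_fin EFinD -!norm1_fin -esumD.
- by apply: le_esum => g _; rewrite -EFinD lee_fin normcD.
- by move=> g _; rewrite lee_fin normc_ge0.
- by move=> g _; rewrite lee_fin normc_ge0.
Qed.

Fact ell1_normZ (c : R[i]) (a : ell1) :
  ell1_norm (c *: a) = `|c| * ell1_norm a.
Proof.
rewrite normcEC -rmorphM; congr (_%:C)%C; apply: EFin_inj.
by rewrite EFinM -!norm1_fin -esum_normcZ.
Qed.

Fact ell1_norm0 (a : ell1) : ell1_norm a = 0 -> a = 0.
Proof.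
move=> /complexI a0; apply/val_inj/funext => g; apply: Normc.eq0_normc.
by apply/eqP; rewrite eq_le normc_ge0 andbT -a0 normc_le_norm1.
Qed.

HB.instance Definition _ := Lmodule_isNormed.Build R[i] ell1
  ell1_normD ell1_normZ ell1_norm0.

Lemma ell1_normE (a : ell1) : `|a| = (norm1 a)%:C%C.
Proof. by []. Qed.

Fact ell1_dirac_summable (g : G) :
  abs_summable (fun h : G => (h == g)%:R : R[i]^o).
Proof.
rewrite /abs_summable (@esum_supp1 _ _ _ g) ?ltry ?lee_fin ?normc_ge0//.
by move=> h /negPf->; rewrite Normc.normc0.
Qed.
Definition dirac1 (g : G) : ell1 := ell1_of (ell1_dirac_summable g).

Lemma norm1_dirac g : norm1 (dirac1 g) = 1.
Proof.
rewrite /norm1 (@esum_supp1 _ _ _ g)/= ?eqxx ?Normc.normc1 ?lee_fin//.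
by move=> h /negPf->; rewrite Normc.normc0.
Qed.

End Ell1.

Section EllInfty.
Context (R : realType) (G : choiceType).

Definition ellinfty_pred : {pred G -> R[i]^o} := fun f => `[< bounded_fun f >].

Lemma bounded_fun_normcP (f : G -> R[i]^o) :
  bounded_fun f <-> exists M : R, forall g, normc (f g) <= M.
Proof.
split=> [[M [/complex_realP[m ->] Mf]]|[M Mf]].
  exists (m + 1) => g; rewrite -le_normcC; apply: Mf => //.
  by rewrite ltcR ltrDl.
exists M%:C%C; split; first by apply/complex_realP; exists M.
move=> x /ltW Mx g _; apply: le_trans Mx.
by rewrite le_normcC.
Qed.

Fact ellinfty_submod_closed : submod_closed ellinfty_pred.
Proof.
split=> [|c f h /asboolP/bounded_fun_normcP[M Mf] /asboolP/bounded_fun_normcP[N Nh]].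
  apply/asboolP/bounded_fun_normcP; exists 0 => g.
  by rewrite Normc.normc0.
apply/asboolP/bounded_fun_normcP; exists (normc c * M + N) => g.
rewrite (le_trans (normcD _ _))// lerD// Normc.normcM.
by rewrite ler_wpM2l// normc_ge0.
Qed.

HB.instance Definition _ := GRing.isSubmodClosed.Build R[i] (G -> R[i]^o)
  ellinfty_pred ellinfty_submod_closed.

Record ellinfty :=
  EllInfty { ellinfty_fun :> G -> R[i]^o; _ : ellinfty_fun \in ellinfty_pred }.

HB.instance Definition _ := [isSub for ellinfty_fun].
HB.instance Definition _ := [Choice of ellinfty by <:].
HB.instance Definition _ := [SubChoice_isSubLmodule of ellinfty by <:].

Lemma ellinfty_bounded (f : ellinfty) : bounded_fun f.
Proof. by case: f => f fP; exact/asboolP. Qed.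

Definition ellinfty_of (f : G -> R[i]^o) (bf : bounded_fun f) : ellinfty :=
  EllInfty (asboolT bf).

Definition normoo (f : ellinfty) : R := sup (range (fun g => normc (f g))).

Lemma normc_le_normoo (f : ellinfty) g : normc (f g) <= normoo f.
Proof.
have /bounded_fun_normcP[M Mf] := ellinfty_bounded f.
by apply: ub_le_sup; [exists M => _ [h _ <-]|exists g].
Qed.

Lemma normoo_le (f : ellinfty) (c : R) : 0 <= c ->
  (forall g, normc (f g) <= c) -> normoo f <= c.
Proof.
move=> c0 fc; have [[x [g _ _]]|/set0P/negP/negPn/eqP f0] :=
  pselect (range (fun g => normc (f g)) !=set0).
  by apply: ge_sup; [exists (normc (f g)), g|move=> _ [h _ <-]].
by rewrite /normoo f0 sup0.
Qed.

Lemma normoo_ge0 (f : ellinfty) : 0 <= normoo f.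
Proof.
have [[x [g _ _]]|/set0P/negP/negPn/eqP f0] :=
  pselect (range (fun g => normc (f g)) !=set0).
  exact: le_trans (normc_ge0 _) (normc_le_normoo f g).
by rewrite /normoo f0 sup0.
Qed.

Lemma ellinftyDE (f h : ellinfty) g : (f + h) g = f g + h g. Proof. by []. Qed.
Lemma ellinftyZE (c : R[i]) (f : ellinfty) g : (c *: f) g = c * f g.
Proof. by []. Qed.

Let ellinfty_norm (f : ellinfty) : R[i] := (normoo f)%:C%C.

Fact ellinfty_normD (f h : ellinfty) :
  ellinfty_norm (f + h) <= ellinfty_norm f + ellinfty_norm h.
Proof.
rewrite -rmorphD lecR; apply: normoo_le; first by rewrite addr_ge0 ?normoo_ge0.
move=> g; rewrite (le_trans (normcD _ _))// lerD ?normc_le_normoo//.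
Qed.

Fact ellinfty_normZ (c : R[i]) (f : ellinfty) :
  ellinfty_norm (c *: f) = `|c| * ellinfty_norm f.
Proof.
have le (k : R[i]) (h : ellinfty) : normoo (k *: h) <= normc k * normoo h.
  apply: normoo_le => [|g]; first by rewrite mulr_ge0 ?normc_ge0 ?normoo_ge0.
  by rewrite Normc.normcM ler_wpM2l ?normc_ge0 ?normc_le_normoo.
rewrite normcEC -rmorphM; congr (_%:C)%C; apply/eqP; rewrite eq_le le/=.
have [->|c0] := eqVneq c 0; first by rewrite Normc.normc0 mul0r normoo_ge0.
have nc0 : 0 < normc c.
  by rewrite lt_def normc_ge0 andbT; apply: contra c0 => /eqP/Normc.eq0_normc ->.
rewrite -ler_pdivlMl// -Normc.normcV; apply: le_trans (le _ _).
by rewrite scalerA mulVf// scale1r.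
Qed.

Fact ellinfty_norm0 (f : ellinfty) : ellinfty_norm f = 0 -> f = 0.
Proof.
move=> /complexI f0; apply/val_inj/funext => g; apply: Normc.eq0_normc.
by apply/eqP; rewrite eq_le normc_ge0 andbT -f0 normc_le_normoo.
Qed.

HB.instance Definition _ := Lmodule_isNormed.Build R[i] ellinfty
  ellinfty_normD ellinfty_normZ ellinfty_norm0.

Lemma ellinfty_normE (f : ellinfty) : `|f| = (normoo f)%:C%C.
Proof. by []. Qed.

Fact ellinfty_mul_bounded (f h : ellinfty) :
  bounded_fun (fun g => f g * h g : R[i]^o).
Proof.
apply/bounded_fun_normcP; exists (normoo f * normoo h) => g.
by rewrite Normc.normcM ler_pM ?normc_ge0 ?normc_le_normoo.
Qed.
Definition ellinfty_mul (f h : ellinfty) : ellinfty :=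
  ellinfty_of (ellinfty_mul_bounded f h).

Definition c_zero : set ellinfty :=
  [set f | forall e : R, 0 < e -> finite_set [set g | e <= normc (f g)]].

End EllInfty.

Section Dual.
Context (K : numFieldType) (V : normedModType K).

Definition dual_pred : {pred V -> K^o} :=
  fun f => `[< linear f /\ continuous f >].

Fact dual_submod_closed : submod_closed dual_pred.
Proof.
split=> [|c f h /asboolP[lf cf] /asboolP[lh ch]]; apply/asboolP; split.
- by move=> k u v; rewrite [LHS]/= scaler0 addr0.
- by move=> x; exact: cst_continuous.
- move=> k u v; rewrite /= /GRing.add/= /GRing.scale/= lf lh.
  by rewrite /GRing.scale/= !mulrDr addrACA; congr (_ + _ + _);
    rewrite mulrCA.
- move=> x; apply: cvgD; last exact: ch.
  by apply: cvgZr; exact: cf.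
Qed.

HB.instance Definition _ := GRing.isSubmodClosed.Build K (V -> K^o)
  dual_pred dual_submod_closed.

Record normed_dual := Dual { dual_fun :> V -> K^o; _ : dual_fun \in dual_pred }.

HB.instance Definition _ := [isSub for dual_fun].
HB.instance Definition _ := [Choice of normed_dual by <:].
HB.instance Definition _ := [SubChoice_isSubLmodule of normed_dual by <:].

(* The weak* topology. *)
HB.instance Definition _ := Topological.copy normed_dual
  (initial_topology (dual_fun : normed_dual -> {ptws V -> K^o})).

Lemma dual_linear (F : normed_dual) : linear F.
Proof. by case: F => f fP; have /asboolP[] := fP. Qed.

Lemma dual_continuous (F : normed_dual) : continuous F.
Proof. by case: F => f fP; have /asboolP[] := fP. Qed.

HB.instance Definition _ (F : normed_dual) :=
  GRing.isLinear.Build K V K^o *:%R F (dual_linear F).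

Lemma dual_bounded (F : normed_dual) :
  exists2 r, 0 <= r & forall x, `|F x| <= r * `|x|.
Proof.
pose f : {linear V -> K^o} := F.
have /(@continuous_linear_bounded K V K^o 0 f) : {for 0, continuous f}.
  exact: dual_continuous.
move=> /linear_boundedP [r [rR rF]]; exists (`|r| + 1) => [|x].
  by rewrite addr_ge0.
by apply: rF; rewrite (le_lt_trans (real_ler_norm rR))// ltrDl.
Qed.

Fact bounded_dual_pred (f : V -> K^o) : linear f ->
  (exists2 r, 0 <= r & forall x, `|f x| <= r * `|x|) -> f \in dual_pred.
Proof.
move=> lf [r r0 rf]; apply/asboolP; split => //.
pose g : {linear V -> K^o} := HB.pack f (GRing.isLinear.Build K V K^o *:%R f lf).
rewrite -[f]/(g : V -> K^o); apply: bounded_linear_continuous.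
apply/linear_boundedP.
near=> s => x; rewrite (le_trans (rf x))// ler_wpM2r//.
by near: s; apply: nbhs_pinfty_ge; exact: ger0_real.
Unshelve. all: by end_near. Qed.

Definition dual_of (f : V -> K^o) (lf : linear f)
    (bf : exists2 r, 0 <= r & forall x, `|f x| <= r * `|x|) : normed_dual :=
  Dual (bounded_dual_pred lf bf).

Lemma weak_star_cvgP (F : set_system normed_dual) (Phi : normed_dual) : Filter F ->
  (F --> Phi) <-> forall x, (fun Psi : normed_dual => Psi x) @ F --> (Phi x : K^o).
Proof.
move=> FF; pose i : normed_dual -> {ptws V -> K^o} := dual_fun.
have -> : (F --> Phi) <-> (i @ F --> i Phi).
  split=> [FPhi A /(@initial_continuous normed_dual {ptws V -> K^o} i) /FPhi//|iF A].
  by rewrite nbhsE => -[_ [[C oC <-] CPhi] CA]; apply: filterS CA (iF _ _);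
    exact: open_nbhs_nbhs.
exact: pointwise_cvgP.
Qed.

End Dual.

Section Pairing.
Context {R : realType} {G : choiceType}.
Implicit Types (S : ellinfty R G) (a b : ell1 R G).

Lemma pairing_summable S a : abs_summable (fun g => S g * a g).
Proof.
apply: (@abs_summable_le _ _ _ (fun g => (normoo S)%:C%C * a g)).
  move=> g; rewrite !Normc.normcM ler_wpM2r ?normc_ge0//.
  rewrite [leRHS]/= expr0n addr0 sqrtr_sqr ger0_norm ?normoo_ge0//.
  exact: normc_le_normoo.
exact/abs_summableZ/ell1_summable.
Qed.

Definition pairing S a : R[i]^o := csum (fun g => S g * a g).

Lemma normc_pairing S a : normc (pairing S a) <= normoo S * norm1 a.
Proof.
rewrite (le_trans (normc_csum (pairing_summable S a)))// -lee_fin fineK; last first.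
  exact/abs_summable_fin/pairing_summable.
rewrite EFinM -norm1_fin -esumZ ?normoo_ge0//; last first.
  by move=> g; rewrite lee_fin normc_ge0.
apply: le_esum => g _; rewrite -EFinM lee_fin Normc.normcM.
by rewrite ler_wpM2r ?normc_ge0 ?normc_le_normoo.
Qed.

Fact pairing_linearl a : linear (pairing^~ a).
Proof.
move=> c S T.
have h := csumD (abs_summableZ c (pairing_summable S a)) (pairing_summable T a).
rewrite (csumZ c (pairing_summable S a)) in h.
rewrite /pairing -[RHS]/(c * csum _ + csum _) -{}h.
by congr csum; apply/funext => g; rewrite mulrA -mulrDl.
Qed.

Fact pairing_linearr S : linear (pairing S).
Proof.
move=> c a b.
have h := csumD (abs_summableZ c (pairing_summable S a)) (pairing_summable S b).
rewrite (csumZ c (pairing_summable S a)) in h.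
rewrite /pairing -[RHS]/(c * csum _ + csum _) -{}h.
by congr csum; apply/funext => g; rewrite mulrCA -mulrDr.
Qed.

Fact pairing_boundedl a :
  exists2 r, 0 <= r & forall S, `|pairing S a| <= r * `|S|.
Proof.
exists (norm1 a)%:C%C => [|S]; first by rewrite ler0c norm1_ge0.
by rewrite ellinfty_normE -rmorphM le_normcC mulrC normc_pairing.
Qed.

Fact pairing_boundedr S :
  exists2 r, 0 <= r & forall a, `|pairing S a| <= r * `|a|.
Proof.
exists (normoo S)%:C%C => [|a]; first by rewrite ler0c normoo_ge0.
by rewrite ell1_normE -rmorphM le_normcC normc_pairing.
Qed.

Definition ellinfty_to_dual S : normed_dual (ell1 R G) :=
  dual_of (pairing_linearr S) (pairing_boundedr S).

Definition ell1_to_bidual a : normed_dual (ellinfty R G) :=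
  dual_of (pairing_linearl a) (pairing_boundedl a).

Lemma ell1_dual_bounded (F : normed_dual (ell1 R G)) :
  exists2 M : R, 0 <= M & forall a, normc (F a) <= M * norm1 a.
Proof.
have [r _ rF] := dual_bounded F.
exists `|complex.Re r| => // a; have := rF a; rewrite normcEC ell1_normE.
case: r {rF} => x y; rewrite lecE/= !mulr0 !subr0 => /andP[_ /le_trans]; apply.
by rewrite ler_wpM2r ?norm1_ge0 ?ler_norm.
Qed.

Fact ell1_repr_bounded (F : normed_dual (ell1 R G)) :
  bounded_fun (fun g => F (dirac1 R g)).
Proof.
have [M _ MF] := ell1_dual_bounded F; apply/bounded_fun_normcP; exists M => g.
by rewrite (le_trans (MF _))// norm1_dirac mulr1.
Qed.

(* The identification $\ell^1(G)^* = \ell^\infty(G)$: [ell1_repr F] is the bounded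
   function representing the functional [F], see [pairing_repr]. *)
Definition ell1_repr (F : normed_dual (ell1 R G)) : ellinfty R G :=
  ellinfty_of (ell1_repr_bounded F).

Lemma pairing_dirac S g : pairing S (dirac1 R g) = S g.
Proof.
rewrite /pairing (@csum_supp1 _ _ _ g) /= ?eqxx ?mulr1// => h /negPf->.
by rewrite mulr0.
Qed.

Lemma ellinfty_to_dualK : cancel ellinfty_to_dual ell1_repr.
Proof. by move=> S; apply/val_inj/funext => g; exact: pairing_dirac. Qed.

Let trunc_sum (X : set G) a : abs_summable (fun g => (g \in X)%:R * a g).
Proof.
apply: abs_summable_le (ell1_summable a) => g.
by case: (g \in X); rewrite ?mul1r// mul0r Normc.normc0 normc_ge0.
Qed.
Let trunc (X : set G) a : ell1 R G := ell1_of (trunc_sum X a).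

Lemma ell1_dual_eq0 (F : normed_dual (ell1 R G)) :
  (forall g, F (dirac1 R g) = 0) -> forall a, F a = 0.
Proof.
move=> F0 a; have [M M0 MF] := ell1_dual_bounded F.
have Ffin (X : set G) : finite_set X -> F (trunc X a) = 0.
  move=> /finite_seqP[s ->]; elim: s => [|x s IHs].
    rewrite (_ : trunc _ a = 0) ?linear0//; apply/val_inj/funext => g /=.
    by rewrite memNset// mul0r.
  have [xs|xs] := boolP (x \in s).
    rewrite (_ : [set` x :: s] = [set` s])//; apply/seteqP; split=> y /=.
      by rewrite inE => /orP[/eqP->|].
    by rewrite inE orbC => ->.
  rewrite (_ : trunc _ a = a x *: dirac1 R x + trunc [set` s] a).
    by rewrite dual_linear IHs F0 scaler0 addr0.
  apply/val_inj/funext => g /=.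
  rewrite -[RHS]/(a x * (g == x)%:R + (g \in [set` s])%:R * a g).
  have memE (t : seq G) : (g \in [set` t]) = (g \in t).
    by apply/idP/idP; rewrite inE.
  rewrite !memE inE; have [->|gx] := eqVneq g x.
    by rewrite (negPf xs)/= mulr1 mul1r mul0r addr0.
  by rewrite /= mulr0 add0r.
apply/Normc.eq0_normc/eqP; rewrite eq_le normc_ge0 andbT.
apply/ler_addgt0Pr => e e0; rewrite add0r.
pose d := e / (M + 1).
have M1 : 0 < M + 1 by rewrite ltr_wpDl.
have d0 : 0 < d by rewrite divr_gt0.
have [_ [X [finX _] <-]] :=
  @ub_ereal_sup_adherent R _ d d0 (abs_summable_fin (ell1_summable a)).
rewrite -esum_fset//; last by move=> g _; rewrite lee_fin normc_ge0.
rewrite -/(esum setT (fun g => (normc (a g))%:E)) norm1_fin.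
set E := (X in (_ < X)%E -> _) => dE.
have EE : E = (norm1 (trunc X a))%:E.
  rewrite -norm1_fin /E esum_mkcond; apply: eq_esum => g _ /=.
  by case: ifPn => _; rewrite ?mul1r// mul0r Normc.normc0.
have rest : norm1 (a - trunc X a) <= d.
  have H : norm1 a = norm1 (trunc X a) + norm1 (a - trunc X a).
    apply: EFin_inj; rewrite EFinD -!norm1_fin -esumD; last 2 first.
    - by move=> g _; rewrite lee_fin normc_ge0.
    - by move=> g _; rewrite lee_fin normc_ge0.
    apply: eq_esum => g _; rewrite -EFinD; congr EFin.
    have -> : trunc X a g = (g \in X)%:R * a g by [].
    have -> : (a - trunc X a) g = a g - (g \in X)%:R * a g by [].
    by case: (g \in X); rewrite ?mul1r ?mul0r ?subrr ?subr0 Normc.normc0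
      ?addr0 ?add0r.
  by move: dE; rewrite EE -EFinB lte_fin H ltrBlDr ltrD2l => /ltW.
have -> : F a = F (a - trunc X a) by rewrite linearB /= Ffin ?subr0.
rewrite (le_trans (MF _))// (le_trans (ler_wpM2l M0 rest))//.
rewrite /d mulrCA -[leRHS]mulr1 ler_wpM2l ?(ltW e0)//.
by rewrite ler_pdivrMr// mul1r lerDl.
Qed.

Lemma ell1_reprK : cancel ell1_repr ellinfty_to_dual.
Proof.
move=> F; apply/val_inj/funext => a; apply/eqP; rewrite eq_sym -subr_eq0.
apply/eqP; apply: (@ell1_dual_eq0 (F - ellinfty_to_dual (ell1_repr F)) _ a) => g.
by rewrite -[LHS]/(F (dirac1 R g) - pairing _ _) pairing_dirac subrr.
Qed.

Lemma pairing_repr (F : normed_dual (ell1 R G)) a : pairing (ell1_repr F) a = F a.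
Proof. by rewrite -[in RHS](ell1_reprK F). Qed.

End Pairing.

Section Convolution.
Context {R : realType} {G : semigroupType}.
Implicit Types (a b : ell1 R G).
Local Open Scope group_scope.

Definition convolution_term (a b : ell1 R G) (t : G) (p : G * G) : R[i] :=
  if p.1 * p.2 == t then (a p.1 * b p.2)%R else 0%R.

Let prod_esum a b :
  (\esum_(p in [set: G * G]) (normc (a p.1 * b p.2)%R)%:E =
   (norm1 a * norm1 b)%:E)%E.
Proof.
transitivity (\esum_(x in [set: G]) \esum_(y in [set: G])
    (normc (a x * b y)%R)%:E)%E.
  rewrite (@esum_esum _ _ _ setT (fun=> setT)
    (fun x y => (normc (a x * b y)%R)%:E)); last first.
    by move=> x y _ _; rewrite lee_fin normc_ge0.
  by congr esum; apply/seteqP; split.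
rewrite EFinM -norm1_fin muleC -esumZ ?norm1_ge0//; last first.
  by move=> x; rewrite lee_fin normc_ge0.
apply: eq_esum => x _.
by rewrite esum_normcZ norm1_fin -!EFinM mulrC.
Qed.

Lemma convolution_term_summable a b t : abs_summable (convolution_term a b t).
Proof.
have h : abs_summable (fun p : G * G => (a p.1 * b p.2)%R).
  by rewrite /abs_summable prod_esum ltry.
apply: abs_summable_le h => p; rewrite /convolution_term.
by case: ifP => // _; rewrite Normc.normc0 normc_ge0.
Qed.

Let convolution_fun a b (t : G) : R[i]^o := csum (convolution_term a b t).

Let convolution_norm_le a b :
  (\esum_(t in [set: G]) (normc (convolution_fun a b t))%:E <=
   (norm1 a * norm1 b)%:E)%E.
Proof.
rewrite -prod_esum.
apply: (@le_trans _ _ (\esum_(t in [set: G]) \esum_(p in [set: G * G])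
    (normc (convolution_term a b t p))%:E)%E).
  apply: le_esum => t _.
  have st := convolution_term_summable a b t.
  rewrite -[leRHS]fineK; last exact: abs_summable_fin.
  by rewrite lee_fin; exact: normc_csum.
rewrite esum_exchange; last by move=> t p; rewrite lee_fin normc_ge0.
apply: le_esum => p _; rewrite (@esum_supp1 _ _ _ (p.1 * p.2)).
- by rewrite /convolution_term eqxx.
- by rewrite lee_fin normc_ge0.
- by move=> t; rewrite /convolution_term eq_sym => /negPf->; rewrite Normc.normc0.
Qed.

Fact convolution_summable a b : abs_summable (convolution_fun a b).
Proof. exact: le_lt_trans (convolution_norm_le a b) (ltry _). Qed.

Definition convolution a b : ell1 R G := ell1_of (convolution_summable a b).

Lemma convolutionE a b t : convolution a b t = csum (convolution_term a b t).
Proof. by []. Qed.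

Lemma norm1_convolution a b : (norm1 (convolution a b) <= norm1 a * norm1 b)%R.
Proof. by rewrite -lee_fin -norm1_fin; exact: convolution_norm_le. Qed.

Fact convolution_linearr a : linear (convolution a).
Proof.
move=> c b b'; apply/val_inj/funext => t.
have h := csumD (abs_summableZ c (convolution_term_summable a b t))
  (convolution_term_summable a b' t).
rewrite (csumZ c (convolution_term_summable a b t)) in h.
rewrite -[RHS]/(c * csum _ + csum _)%R -{}h -[LHS]/(csum _).
congr csum; apply/funext => p; rewrite /convolution_term.
by case: ifP => _; rewrite ?mulr0 ?addr0// mulrCA -mulrDr.
Qed.

Fact convolution_linearl b : linear (convolution^~ b).
Proof.
move=> c a a'; apply/val_inj/funext => t.
have h := csumD (abs_summableZ c (convolution_term_summable a b t))
  (convolution_term_summable a' b t).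
rewrite (csumZ c (convolution_term_summable a b t)) in h.
rewrite -[RHS]/(c * csum _ + csum _)%R -{}h -[LHS]/(csum _).
congr csum; apply/funext => p; rewrite /convolution_term.
by case: ifP => _; rewrite ?mulr0 ?addr0// mulrA -mulrDl.
Qed.

Lemma convolution_dirac (s t : G) : convolution (dirac1 R s) (dirac1 R t) = dirac1 R (s * t).
Proof.
apply/val_inj/funext => g /=; rewrite /convolution_fun.
rewrite (@csum_supp1 _ _ _ (s, t)) /convolution_term /=.
  by rewrite !eqxx mulr1 eq_sym; case: eqP.
move=> [x y] /=; rewrite xpair_eqE; case: ifP => // _.
by case: (x == s) => //=; rewrite ?mul0r// => /negPf->; rewrite mulr0.
Qed.

End Convolution.

Section Arens.
Context {R : realType} {G : semigroupType}.
Implicit Types (a b : ell1 R G) (S : ellinfty R G) (Phi Psi : normed_dual (ellinfty R G)).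

Fact ellinfty_act_linear S a : linear (fun b => pairing S (convolution a b)).
Proof. by move=> c b b'; rewrite convolution_linearr pairing_linearr. Qed.

Fact ellinfty_act_bounded S a :
  exists2 r, 0 <= r & forall b, `|pairing S (convolution a b)| <= r * `|b|.
Proof.
exists (normoo S * norm1 a)%:C%C => [|b].
  by rewrite ler0c mulr_ge0 ?normoo_ge0 ?norm1_ge0.
rewrite ell1_normE -rmorphM le_normcC (le_trans (normc_pairing _ _))//.
by rewrite -mulrA ler_wpM2l ?normoo_ge0 ?norm1_convolution.
Qed.

(* $S \cdot a$, the element of $\ell^\infty(G)$ representing $b\mapsto\langle S,ab\rangle$ *)
Definition ellinfty_act S a : ellinfty R G :=
  ell1_repr (dual_of (ellinfty_act_linear S a) (ellinfty_act_bounded S a)).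

Lemma ellinfty_actE S a b : pairing (ellinfty_act S a) b = pairing S (convolution a b).
Proof. by rewrite pairing_repr. Qed.

Lemma pairing_inj S T : (forall a, pairing S a = pairing T a) -> S = T.
Proof.
by move=> ST; apply/val_inj/funext => g; rewrite /= -!pairing_dirac ST.
Qed.

Lemma normoo_ellinfty_act S a : normoo (ellinfty_act S a) <= normoo S * norm1 a.
Proof.
apply: normoo_le => [|g]; first by rewrite mulr_ge0 ?normoo_ge0 ?norm1_ge0.
rewrite -pairing_dirac ellinfty_actE (le_trans (normc_pairing _ _))//.
rewrite ler_wpM2l ?normoo_ge0// (le_trans (norm1_convolution _ _))//.
by rewrite norm1_dirac mulr1.
Qed.

Fact ellinfty_act_linearr S : linear (ellinfty_act S).
Proof.
move=> c a a'; apply: pairing_inj => b.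
by rewrite pairing_linearl !ellinfty_actE convolution_linearl pairing_linearr.
Qed.

Fact ellinfty_act_linearl a : linear (ellinfty_act^~ a).
Proof.
move=> c S T; apply: pairing_inj => b.
by rewrite pairing_linearl !ellinfty_actE pairing_linearl.
Qed.

Lemma ellinfty_dual_bounded Psi :
  exists2 M : R, 0 <= M & forall S, normc (Psi S) <= M * normoo S.
Proof.
have [r _ rF] := dual_bounded Psi.
exists `|complex.Re r| => // S; have := rF S; rewrite normcEC ellinfty_normE.
case: r {rF} => x y; rewrite lecE/= !mulr0 !subr0 => /andP[_ /le_trans]; apply.
by rewrite ler_wpM2r ?normoo_ge0 ?ler_norm.
Qed.

Fact bidual_act_linear Psi S : linear (fun a => Psi (ellinfty_act S a)).
Proof. by move=> c a b; rewrite ellinfty_act_linearr dual_linear. Qed.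

Fact bidual_act_bounded Psi S :
  exists2 r, 0 <= r & forall a, `|Psi (ellinfty_act S a)| <= r * `|a|.
Proof.
have [M M0 MPsi] := ellinfty_dual_bounded Psi.
exists (M * normoo S)%:C%C => [|a].
  by rewrite ler0c mulr_ge0 ?normoo_ge0.
rewrite ell1_normE -rmorphM le_normcC (le_trans (MPsi _))//.
by rewrite -mulrA ler_wpM2l ?normoo_ellinfty_act.
Qed.

(* $\Psi \cdot S$, the element of $\ell^\infty(G)$ representing
   $a\mapsto\langle\Psi,S\cdot a\rangle$ *)
Definition bidual_act Psi S : ellinfty R G :=
  ell1_repr (dual_of (bidual_act_linear Psi S) (bidual_act_bounded Psi S)).

Lemma bidual_actE Psi S a : pairing (bidual_act Psi S) a = Psi (ellinfty_act S a).
Proof. by rewrite pairing_repr. Qed.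

Fact bidual_act_linearr Psi : linear (bidual_act Psi).
Proof.
move=> c S T; apply: pairing_inj => a.
by rewrite pairing_linearl !bidual_actE ellinfty_act_linearl dual_linear.
Qed.

Fact arens_product_linear Phi Psi : linear (fun S => Phi (bidual_act Psi S)).
Proof. by move=> c S T; rewrite bidual_act_linearr dual_linear. Qed.

Fact arens_product_bounded Phi Psi :
  exists2 r, 0 <= r & forall S, `|Phi (bidual_act Psi S)| <= r * `|S|.
Proof.
have [M M0 MPhi] := ellinfty_dual_bounded Phi.
have [N N0 NPsi] := ellinfty_dual_bounded Psi.
exists (M * N)%:C%C => [|S]; first by rewrite ler0c mulr_ge0.
rewrite ellinfty_normE -rmorphM le_normcC (le_trans (MPhi _))//.
rewrite -mulrA ler_wpM2l//; apply: normoo_le => [|g].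
  by rewrite mulr_ge0 ?normoo_ge0.
rewrite -pairing_dirac bidual_actE (le_trans (NPsi _))// ler_wpM2l//.
by rewrite (le_trans (normoo_ellinfty_act _ _))// norm1_dirac mulr1.
Qed.

Definition arens_product Phi Psi : normed_dual (ellinfty R G) :=
  dual_of (arens_product_linear Phi Psi) (arens_product_bounded Phi Psi).

Lemma arens_productE Phi Psi S : arens_product Phi Psi S = Phi (bidual_act Psi S).
Proof. by []. Qed.

End Arens.

Definition weakly_cancellative (G : semigroupType) : Prop :=
  forall s t : G, finite_set [set u | (s * u)%g = t] /\
                  finite_set [set u | (u * s)%g = t].

Definition right_cancellative (G : semigroupType) : Prop :=
  forall s t : G, is_subset1 [set u | (u * s)%g = t].

Section TopologicalCentre.
Context (R : realType) (G : semigroupType).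

Fact ev_linear (g : G) : linear (fun S : ellinfty R G => S g).
Proof. by []. Qed.

Fact ev_bounded (g : G) :
  exists2 r, 0 <= r & forall S : ellinfty R G, `|S g| <= r * `|S|.
Proof.
by exists 1 => // S; rewrite mul1r ellinfty_normE le_normcC normc_le_normoo.
Qed.

Definition point_evaluation (g : G) : normed_dual (ellinfty R G) :=
  dual_of (ev_linear g) (ev_bounded g).

Definition c_zero_perp : set (normed_dual (ellinfty R G)) :=
  [set Phi | forall S, c_zero S -> Phi S = 0].

(* The spectrum of $\ell^\infty(G)$: its nonzero multiplicative functionals. *)
Definition betaG : set (normed_dual (ellinfty R G)) :=
  [set Phi | Phi <> 0 /\ forall S T, Phi (ellinfty_mul S T) = Phi S * Phi T].

Definition betaG_remainder : set (normed_dual (ellinfty R G)) :=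
  betaG `\` range point_evaluation.

Definition first_topological_centre (X : set (normed_dual (ellinfty R G))) :
    set (normed_dual (ellinfty R G)) :=
  [set Psi | X Psi /\ {within X, continuous (fun Phi => arens_product Psi Phi)}].

End TopologicalCentre.

(* Main.v *)
Require Import Defs.
From HB Require Import structures.
From mathcomp Require Import all_boot all_order all_algebra.
From mathcomp Require Import complex finmap.
From mathcomp Require Import all_classical all_reals all_analysis.
From mathcomp Require wochoice.

Set Implicit Arguments.
Unset Strict Implicit.
Unset Printing Implicit Defensive.
Import Order.TTheory GRing.Theory Num.Theory.
Import numFieldNormedType.Exports.

Local Open Scope classical_set_scope.
Local Open Scope ring_scope.

(* All four centres reduce to one claim: if $\Psi$ vanishes on the indicators of points
   and $\Phi\mapsto\Psi\Phi$ is weak*-continuous on the characters in $G^*$ that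
   annihilate $c_0(G)$, then $\Psi=0$.

   Fix $f\in\ell^\infty(G)$ and, for $F\subset G$ finite, let $f_F=f1_F$. Index by the
   pairs $(F,K)$ of finite subsets of $G$, of which there are $|G|$ many. A transfinite
   recursion, driven by weak cancellativity, gives distinct $x_{F,K}\in G$ with the sets
   $Kx_{F,K}$ pairwise disjoint; by right cancellativity one bounded $S$ then satisfies
   $S(gx_{F,K})=f_F(g)$ for all $g\in K$. With $\Phi_F$ the limit of $x_{F,K}$ along an
   ultrafilter in $K$ and $\Phi$ the limit of $\Phi_F$ along one in $F$ we get
   $\Phi_F\cdot S=f_F$ and $\Phi\cdot S=f$, so $\Psi(f)=\lim\Psi(f_F)=0$.

   For the bidual the claim is applied to $\Psi-a$, where $a(g)=\Psi(1_{\{g\}})$ is in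
   $\ell^1(G)$; in $\beta G$ a character with $\Psi(1_{\{g\}})\ne0$ is evaluation at $g$. *)

(** * Infinite cardinals *)

Definition injects (T : Type) (A B : set T) : Prop :=
  exists f : T -> T, (forall x, A x -> B (f x)) /\
    (forall x y, A x -> A y -> f x = f y -> x = y).

Lemma injects_total (T : Type) (A B : set T) : injects A B \/ injects B A.
Proof.
pose P := [set E : set (T * T) |
  [/\ forall x y, E (x, y) -> A x /\ B y,
      forall x y y', E (x, y) -> E (x, y') -> y = y' &
      forall x x' y, E (x, y) -> E (x', y) -> x = x']].
have [F FP totF|E [[EAB Ef Ei] maxE]] := @Zorn_bigcup _ P.
  have join u v : (\bigcup_(X in F) X) u -> (\bigcup_(X in F) X) v ->
      exists X, [/\ F X, X u & X v].
    move=> [X FX Xu] [Y FY Yv]; have [XY|YX] := totF _ _ FX FY.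
      by exists Y; split => //; exact: XY.
    by exists X; split => //; exact: YX.
  split=> [x y [X FX Xxy]|x y y' Exy Exy'|x x' y Exy Ex'y].
  - by have [+ _ _] := FP _ FX; apply.
  - by have [X [FX Xu Xv]] := join _ _ Exy Exy'; have [_ + _] := FP _ FX; apply; eauto.
  - by have [X [FX Xu Xv]] := join _ _ Exy Ex'y; have [_ _] := FP _ FX; apply; eauto.
have [domE|/existsNP[a /not_implyP[Aa /forallNP aE]]] :=
  pselect (forall a, A a -> exists b, E (a, b)).
  left; have /choice[f fE] : forall a, exists b, A a -> E (a, b).
    move=> a; have [/domE[b]|nAa] := pselect (A a); first by exists b.
    by exists a.
  exists f; split=> [x Ax|x y Ax Ay fxy]; first by have [] := EAB _ _ (fE x Ax).
  by apply: (Ei x y (f x)); [exact: fE|rewrite fxy; exact: fE].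
have [ranE|/existsNP[b /not_implyP[Bb /forallNP bE]]] :=
  pselect (forall b, B b -> exists a, E (a, b)).
  right; have /choice[f fE] : forall b, exists a, B b -> E (a, b).
    move=> b; have [/ranE[c]|nBb] := pselect (B b); first by exists c.
    by exists b.
  exists f; split=> [x Bx|x y Bx By fxy]; first by have [] := EAB _ _ (fE x Bx).
  by apply: (Ef (f x)); [exact: fE|rewrite fxy; exact: fE].
exfalso; apply: (maxE (E `|` [set (a, b)])).
  by split=> [u Eu|/(_ (a, b))]; [left|move/(_ (or_intror erefl)) /aE].
split=> [x y [/EAB//|[-> ->]//]|x y y' [Exy|[xE ->]] [Exy'|[xE' ->]]
  |x x' y [Exy|[-> yE]] [Ex'y|[-> yE']]] //.
- exact: Ef Exy Exy'.
- by rewrite xE' in Exy; case: (aE _ Exy).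
- by rewrite xE in Exy'; case: (aE _ Exy').
- exact: Ei Exy Ex'y.
- by rewrite yE' in Exy; case: (bE _ Exy).
- by rewrite yE in Ex'y; case: (bE _ Ex'y).
Qed.

Lemma infinite_nat_inj (T : Type) (A : set T) : infinite_set A ->
  exists2 e : nat -> T, (forall n, A (e n)) & injective e.
Proof.
move=> infA; have [a _] := infinite_setN0 infA.
move/infiniteP/card_leP: infA => [f].
exists (fun n => val (f (SigSub (mem_set (I : [set: nat] n))))) => [n|m n /val_inj fmn].
  exact/set_mem/valP.
by have /(congr1 val) := 'inj_f (mem_set I) (mem_set I) fmn.
Qed.

(** The graph of an injection $A\times A\to A$. The set $A$ is read off as a projection of [E], so
    that pairings of varying sets are ordered by plain inclusion. *)
Definition pairing_on (T : Type) (E : set (T * T * T)) : Prop :=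
  let A := [set a | exists b c, E (a, b, c)] in
  [/\ forall a b c c', E (a, b, c) -> E (a, b, c') -> c = c',
      forall a b a' b' c, E (a, b, c) -> E (a', b', c) -> a = a' /\ b = b',
      forall a b c, E (a, b, c) -> A b /\ A c &
      forall a b, A a -> A b -> exists c, E (a, b, c)].

(** Each clause concerns at most two triples, and in a chain these lie in a common member. *)
Lemma pairing_on_bigcup (T : Type) (F : set (set (T * T * T))) :
  F `<=` @pairing_on T -> total_on F subset -> pairing_on (\bigcup_(X in F) X).
Proof.
move=> FP totF.
have join u v : (\bigcup_(X in F) X) u -> (\bigcup_(X in F) X) v ->
    exists X, [/\ F X, X u & X v].
  move=> [X FX Xu] [Y FY Yv]; have [XY|YX] := totF _ _ FX FY.
    by exists Y; split => //; exact: XY.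
  by exists X; split => //; exact: YX.
split=> [a b c c' E1 E2|a b a' b' c E1 E2|a b c [X FX Xu]|a b [d [c E1]] [d' [c' E2]]].
- by have [X [FX Xu Xv]] := join _ _ E1 E2; have [+ _ _ _] := FP _ FX; apply; eauto.
- by have [X [FX Xu Xv]] := join _ _ E1 E2; have [_ + _ _] := FP _ FX; apply; eauto.
- have [_ _ + _] := FP _ FX => /(_ _ _ _ Xu)[[b1 [c1 Xb]] [b2 [c2 Xc]]].
  by split; [exists b1, c1, X|exists b2, c2, X].
- have [X [FX Xu Xv]] := join _ _ E1 E2; have [_ _ _ +] := FP _ FX.
  by move=> /(_ a b)[||c0 Xc0]; [exists d, c|exists d', c'|exists c0, X].
Qed.

(* The extension step: if [~` A] contains a copy [h @` A] of [A], then the three new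
   blocks of [(A `|` h @` A) ^ 2] are sent into [h @` A], tagged by three points of [A]. *)
Lemma pairing_on_extend (T : Type) (E : set (T * T * T)) (t : 'I_3 -> T) (h : T -> T) :
  pairing_on E -> injective t ->
  let A := [set a | exists b c, E (a, b, c)] in
  (forall i, A (t i)) -> (forall x, A x -> ~ A (h x)) ->
  (forall x y, A x -> A y -> h x = h y -> x = y) ->
  exists2 E', pairing_on E' & E `<` E'.
Proof.
move=> [Ef Ei Ecl Etot] t_inj A At hA h_inj.
have /choice[q qE] : forall ab : T * T, exists c, A ab.1 -> A ab.2 -> E (ab.1, ab.2, c).
  move=> [a b]; have [[Aa Ab]|nA] := pselect (A a /\ A b).
    by have [c] := Etot _ _ Aa Ab; exists c.
  by exists a => Aa Ab; case: nA.
pose p a b := q (a, b).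
have pE a b : A a -> A b -> E (a, b, p a b) by exact: (qE (a, b)).
have Ap a b : A a -> A b -> A (p a b) by move=> Aa Ab; have [] := Ecl _ _ _ (pE _ _ Aa Ab).
have EA a b c : E (a, b, c) -> [/\ A a, A b & A c].
  by move=> Eabc; have [] := Ecl _ _ _ Eabc; split => //; exists b, c.
have p_inj a b a' b' : A a -> A b -> A a' -> A b' -> p a b = p a' b' -> a = a' /\ b = b'.
  move=> Aa Ab Aa' Ab' pp; apply: (Ei _ _ _ _ (p a b)); first exact: pE.
  by rewrite pp; exact: pE.
(* The new values: [p] codes $(a,b)$ together with the tag inside $A$, and [h] carries the code out
   of $A$. *)
pose k i a b := h (p (t i) (p a b)).
have Ak i a b : A a -> A b -> ~ A (k i a b) by move=> Aa Ab; apply/hA/Ap => //; exact: Ap.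
have k_inj i a b i' a' b' : A a -> A b -> A a' -> A b' -> k i a b = k i' a' b' ->
    [/\ i = i', a = a' & b = b'].
  move=> Aa Ab Aa' Ab' /h_inj.
  have Apab := Ap _ _ Aa Ab; have Apab' := Ap _ _ Aa' Ab'.
  move=> /(_ (Ap _ _ (At _) Apab) (Ap _ _ (At _) Apab')).
  move=> /(p_inj _ _ _ _ (At _) Apab (At _) Apab')[/t_inj ->].
  by move=> /(p_inj _ _ _ _ Aa Ab Aa' Ab')[-> ->].
(* The booleans record which coordinates lie in the copy of $A$. The blocks with [e || e'] get the
   tags 0, 1, 2; the old block, excluded in [N], would collide with tag 0 by truncated
   subtraction. *)
pose s (e : bool) x := if e then h x else x.
pose tag (e e' : bool) : 'I_3 := inord (e.*2 + e' - 1).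
have tag_inj e1 e2 e1' e2' : e1 || e2 -> e1' || e2' -> tag e1 e2 = tag e1' e2' ->
    e1 = e1' /\ e2 = e2'.
  move=> H H' /(congr1 val); rewrite /tag /= !inordK; last 2 first.
  - by case: e1' {H'}; case: e2'.
  - by case: e1 {H}; case: e2.
  by case: e1 H; case: e2 => //=; case: e1' H'; case: e2'.
pose N := [set u : T * T * T | exists e e' a b,
  [/\ e || e', A a, A b & u = (s e a, s e' b, k (tag e e') a b)]].
have sA e a : A a -> A (s e a) -> e = false by case: e => //= Aa Ah; case: (hA _ Aa).
have s_inj e a e' a' : A a -> A a' -> s e a = s e' a' -> e = e' /\ a = a'.
  case: e; case: e' => //= Aa Aa'.
  - by move=> /h_inj ->.
  - by move=> hE; case: (hA a) => //; rewrite hE.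
  - by move=> hE; case: (hA a') => //; rewrite -hE.
have EN a b c c' : E (a, b, c) -> N (a, b, c') -> False.
  move=> /EA[Aa Ab _] [e [e' [a' [b' [ee Aa' Ab' [aE bE _]]]]]].
  move: ee Aa Ab; rewrite aE bE => /orP[|] + /(sA _ _ Aa') + /(sA _ _ Ab').
    by move=> -> .
  by move=> -> .
have EN' a b a' b' c : E (a, b, c) -> N (a', b', c) -> False.
  move=> /EA[_ _ Ac] [e [e' [x [y [ee Ax Ay [_ _ cE]]]]]].
  by case: (Ak (tag e e') x y) => //; rewrite -cE.
have A'h a : A a -> exists b c, (E `|` N) (h a, b, c).
  move=> Aa; exists a, (k (tag true false) a a); right.
  by exists true, false, a, a.
have A's e a : A a -> exists b c, (E `|` N) (s e a, b, c).
  move=> Aa; case: e; first exact: A'h.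
  by have [b [c Eabc]] := Aa; exists b, c; left.
have A'E a : (exists b c, (E `|` N) (a, b, c)) -> exists e x, A x /\ a = s e x.
  move=> [b [c [Eabc|[e [e' [x [y [_ Ax _ [-> _ _]]]]]]]]]; last by exists e, x.
  by exists false, a; have [] := EA _ _ _ Eabc.
exists (E `|` N); last first.
  (* The inclusion is strict because [h (t ord0)] lies in the new domain but not in $A$. *)
  split=> [u|EN0]; first by left.
  have [e0 [c0 Eh]] := A'h _ (At ord0).
  case: (hA (t ord0)) => //; exists e0, c0; apply: EN0; exact: Eh.
split.
- move=> a b c c' [E1|N1] [E2|N2]; first exact: Ef E1 E2.
  + by case: (EN _ _ _ _ E1 N2).
  + by case: (EN _ _ _ _ E2 N1).
  move: N1 N2 => [e [e' [x [y [_ Ax Ay [-> -> ->]]]]]].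
  move=> [f [f' [x' [y' [_ Ax' Ay' [E1 E2 ->]]]]]].
  by have [-> ->] := s_inj _ _ _ _ Ax Ax' E1; have [-> ->] := s_inj _ _ _ _ Ay Ay' E2.
- move=> a b a' b' c [E1|N1] [E2|N2]; first exact: Ei E1 E2.
  + by case: (EN' _ _ _ _ _ E1 N2).
  + by case: (EN' _ _ _ _ _ E2 N1).
  move: N1 N2 => [e [e' [x [y [ee Ax Ay [-> -> ->]]]]]].
  move=> [f [f' [x' [y' [ff Ax' Ay' [aE bE E1]]]]]].
  have [E2 xE yE] := k_inj _ _ _ _ _ _ Ax Ay Ax' Ay' E1.
  by have [eE e'E] := tag_inj _ _ _ _ ee ff E2; rewrite aE bE xE yE eE e'E.
- move=> a b c [/EA[_ Ab Ac]|[e [e' [x [y [ee Ax Ay [_ -> ->]]]]]]].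
    by split; [exact: (A's false)|exact: (A's false)].
  split; first exact: A's.
  by apply: A'h; apply: (Ap) => //; exact: Ap.
- move=> a b /A'E[e [x [Ax ->]]] /A'E[e' [y [Ay ->]]].
  have [ee|ee] := boolP (e || e').
    by exists (k (tag e e') x y); right; exists e, e', x, y.
  exists (p x y); left; move: ee; rewrite negb_or => /andP[/negPf-> /negPf->].
  exact: pE.
Qed.

(* Hessenberg's theorem, by Zorn's lemma on the pairings of subsets of [T]. *)
Lemma infinite_pairing (T : Type) : infinite_set [set: T] ->
  exists p : T -> T -> T, forall a b a' b', p a b = p a' b' -> a = a' /\ b = b'.
Proof.
move=> /infinite_nat_inj[e _ e_inj].
pose E0 := [set u : T * T * T | exists i j, u = (e i, e j, e (choice.pickle (i, j)))].
(* The alternative [E = set0] admits the union of the empty chain; a maximal [E] contains [E0], so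
   its domain is infinite. *)
pose P := [set E | pairing_on E /\ (E = set0 \/ E0 `<=` E)].
have E0P : pairing_on E0.
  split.
  - by move=> a b c c' [i [j [-> -> ->]]] [i' [j' [/e_inj <- /e_inj <- ->]]].
  - move=> a b a' b' c [i [j [-> -> ->]]] [i' [j' [-> -> /e_inj]]].
    by move=> /(pcan_inj choice.pickleK)[-> ->].
  - move=> a b c [i [j [_ -> ->]]].
    by split; do 2!eexists; [exists j, 0%N|exists (choice.pickle (i, j)), 0%N].
  - move=> a b [_ [_ [i [_ [-> _ _]]]]] [_ [_ [j [_ [-> _ _]]]]].
    by eexists; exists i, j.
have [F FP totF|E [[EP E0E] maxE]] := @Zorn_bigcup _ P.
  split; first by apply: pairing_on_bigcup totF => X /FP[].
  have [[X [FX EX]]|nX] := pselect (exists X, F X /\ E0 `<=` X).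
    by right=> u /EX; exists X.
  left; apply/seteqP; split=> // u [X FX Xu]; case: nX; exists X; split=> //.
  by have [_ [X0|//]] := FP _ FX; rewrite X0 in Xu.
have {E0E} E0E : E0 `<=` E.
  case: E0E => // EE; rewrite {}EE in maxE EP; case: (maxE E0); last by split=> //; right.
  by split=> // /(_ (e 0%N, e 0%N, e (choice.pickle (0%N, 0%N)))); apply; exists 0%N, 0%N.
pose A := [set a | exists b c, E (a, b, c)].
have Ae n : A (e n).
  by exists (e 0%N), (e (choice.pickle (n, 0%N))); apply: E0E; exists n, 0%N.
have [[h [hA h_inj]]|[h [hA h_inj]]] := injects_total A (~` A).
  have [|i|E' E'P EE'] := @pairing_on_extend _ E (fun i => e i) h EP _ _ hA h_inj.
  - by move=> i j /e_inj/val_inj.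
  - exact: Ae.
  case: (maxE E' EE'); split=> //; right.
  by case: EE' => EE' _ u /E0E/EE'.
have [Ef Ei Ecl Etot] := EP.
have /choice[q qE] : forall ab : T * T, exists c, A ab.1 -> A ab.2 -> E (ab.1, ab.2, c).
  move=> [a b]; have [[Aa Ab]|nA] := pselect (A a /\ A b).
    by have [c] := Etot _ _ Aa Ab; exists c.
  by exists a => Aa Ab; case: nA.
pose p a b := q (a, b).
have pE a b : A a -> A b -> E (a, b, p a b) by exact: (qE (a, b)).
have Ap a b : A a -> A b -> A (p a b) by move=> Aa Ab; have [] := Ecl _ _ _ (pE _ _ Aa Ab).
have p_inj a b a' b' : A a -> A b -> A a' -> A b' -> p a b = p a' b' -> a = a' /\ b = b'.
  move=> Aa Ab Aa' Ab' pp; apply: (Ei _ _ _ _ (p a b)); first exact: pE.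
  by rewrite pp; exact: pE.
(* Here the complement of $A$ embeds in $A$, so all of [T] does: the tags [e 0] and [e 1] keep $A$
   and its complement apart. *)
pose r x := if pselect (A x) then p (e 0%N) x else p (e 1%N) (h x).
have Ar x : A (r x) by rewrite /r; case: pselect => Ax; apply: Ap => //; exact: hA.
have r_inj : injective r.
  move=> x y; rewrite /r; case: pselect => Ax; case: pselect => Ay.
  - by move=> /(p_inj _ _ _ _ (Ae _) Ax (Ae _) Ay)[].
  - by move=> /(p_inj _ _ _ _ (Ae _) Ax (Ae _) (hA _ Ay))[/e_inj].
  - by move=> /(p_inj _ _ _ _ (Ae _) (hA _ Ax) (Ae _) Ay)[/e_inj].
  - by move=> /(p_inj _ _ _ _ (Ae _) (hA _ Ax) (Ae _) (hA _ Ay))[_ /h_inj]; apply.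
exists (fun a b => p (r a) (r b)) => a b a' b' /p_inj[] //.
by move=> /r_inj-> /r_inj->.
Qed.

(** The iterated pairing of the entries does not show where the list ends, so the length is coded
    along with it. *)
Lemma infinite_seq_code (T : Type) : infinite_set [set: T] ->
  exists c : seq T -> T, injective c.
Proof.
move=> infT; have [p p_inj] := infinite_pairing infT.
have [e _ e_inj] := infinite_nat_inj infT.
exists (fun s => p (e (size s)) (foldr p (e 0%N) s)) => s s' /p_inj[/e_inj].
elim: s s' => [|x s IHs] [|y s'] //= [ss] /p_inj[-> ss'].
by congr cons; exact: IHs.
Qed.

(** A point is determined by the index of a finite set containing it and its position in a list of
    that set; $S\times\mathbb N$ embeds in $S$ since $S$ must be infinite. Thus fewer than $|T|$
    finite sets do not cover [T]. *)
Lemma finite_cover_injects (T : choiceType) (S : set T) (B : T -> set T) :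
  infinite_set [set: T] -> (forall j, finite_set (B j)) ->
  [set: T] `<=` \bigcup_(j in S) B j -> injects [set: T] S.
Proof.
move=> infT finB cov.
have infS : infinite_set S.
  move=> finS; apply: infT; apply: sub_finite_set cov _.
  exact: bigcup_finite.
have [p p_inj] : exists p : S -> S -> S,
    forall a b a' b', p a b = p a' b' -> a = a' /\ b = b'.
  apply: infinite_pairing; apply: contra_not infS.
  by rewrite (eq_finite_set (card_setT S)).
have [e eS e_inj] := infinite_nat_inj infS.
have /choice[s sB] : forall j, exists s : seq T, B j = [set` s].
  by move=> j; have /finite_seqP := finB j.
have /choice[j jB] : forall u, exists j, S j /\ B j u.
  by move=> u; have [j] := cov u I; exists j.
pose J u : S := SigSub (mem_set (jB u).1).
pose N u : S := SigSub (mem_set (eS (index u (s (j u))))).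
exists (fun u => val (p (J u) (N u))); split=> [u _|u v _ _ /val_inj/p_inj].
  exact/set_mem/valP.
move=> [/(congr1 val)/= jj /(congr1 val)/= /e_inj ii].
have inS w : w \in s (j w) by have [_] := jB w; rewrite sB.
by rewrite -(nth_index u (inS u)) ii jj nth_index // -jj.
Qed.

(** If some initial segment is as large as [T], let [e] embed [T] into the segment of the least such
    point; otherwise let [e] be the identity. Either way the segments below values of [e] are
    smaller than [T]. *)
Lemma minimal_well_order (T : eqType) : exists (lt : T -> T -> Prop) (e : T -> T),
  [/\ well_founded lt, (forall x y, x <> y -> lt x y \/ lt y x), injective e &
    forall i, ~ injects [set: T] [set j | lt j (e i)]].
Proof.
have [R woR] := wochoice.well_ordering_principle T.
pose lt x y := R x y /\ x <> y.
have least (P : T -> Prop) : (exists x, P x) ->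
    exists2 x, P x & forall y, P y -> R x y.
  move=> [x Px]; have [|z [[Pz lez] _]] := woR [pred x | `[< P x >]].
    by exists x; exact/asboolP.
  by exists z; [exact/asboolP|move=> y Py; apply: lez; exact/asboolP].
have Ranti x y : R x y -> R y x -> x = y.
  have Rxx z : R z z by have [|_ -> /(_ z erefl)] := least (fun w => w = z); first by exists z.
  move=> Rxy Ryx; have [|z [_ uz]] := woR (pred2 x y); first by exists x; rewrite !inE eqxx.
  rewrite -(uz x) ?(uz y)//; split; rewrite ?inE ?eqxx ?orbT// => w;
    by rewrite !inE => /orP[] /eqP->.
have Rtot x y : R x y \/ R y x.
  have [|z [->|->] lez] := least (fun z => z = x \/ z = y); first by exists x; left.
    by left; apply: lez; right.
  by right; apply: lez; left.
have wf : well_founded lt.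
  move=> x; apply: contrapT => nx.
  have [|z nz lez] := least (fun x => ~ Acc lt x); first by exists x.
  apply: nz; split=> y [Ryz yz]; apply: contrapT => /lez Rzy.
  by apply: yz; exact: Ranti.
have tri x y : x <> y -> lt x y \/ lt y x.
  move=> xy; have [Rxy|Ryx] := Rtot x y; [left|right]; split=> //.
  by move=> yx; exact: xy.
have [[i0 inj0]|ninj] := pselect (exists i, injects [set: T] [set j | lt j i]).
  have [|i [f [fi f_inj]] lei] := least (fun i => injects [set: T] [set j | lt j i]).
    by exists i0.
  exists lt, f; split=> // [x y|j /lei Rij]; first exact: f_inj.
  by have [Rfi neq] := fi j I; apply: neq; exact: Ranti.
exists lt, id; split=> // i inji; apply: ninj; by exists i.
Qed.

(* Transfinite recursion along a well-order of $G$ of minimal type: at each stage fewer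
   than $|G|$ finite sets, hence not all of $G$, have to be avoided. *)
Lemma disjoint_translates (G : semigroupType) :
  infinite_set [set: G] ->
  (forall s t : G, finite_set [set u | (s * u)%g = t]) ->
  exists2 x : seq G * seq G -> G, injective x &
    forall i j g g', g \in i.2 -> g' \in j.2 -> (g * x i)%g = (g' * x j)%g -> i = j.
Proof.
move=> infG finG.
have [lt [e [wf tri e_inj minG]]] := minimal_well_order G.
have [p p_inj] := infinite_pairing infG.
have [c c_inj] := infinite_seq_code infG.
(* [d i] is the stage at which the pair [i] is served; being a value of [e], it has fewer than $|G|$
   predecessors. *)
pose d i := e (p (c i.1) (c i.2)).
have d_inj : injective d.
  by move=> [s s'] [t t'] /e_inj/p_inj[/c_inj/= -> /c_inj/= ->].
have /choice[K KE] : forall k : G, exists s : seq G, forall i, k = d i -> s = i.2.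
  move=> k; have [[i ->]|nk] := pselect (exists i, k = d i).
    by exists i.2 => j /d_inj ->.
  by exists [::] => i ki; case: nk; exists i.
pose bad k (u : G) j (v : G) : Prop :=
  u = v \/ exists g g', [/\ g \in K k, g' \in K j & (g * u)%g = (g' * v)%g].
have bad_fin k j v : finite_set [set u | bad k u j v].
  apply: (@sub_finite_set _ _ ([set v] `|`
      \bigcup_(g in [set` K k]) \bigcup_(g' in [set` K j]) [set u | (g * u)%g = (g' * v)%g])).
    by move=> u [->|[g [g' [gk gj E]]]]; [left|right; exists g => //; exists g'].
  rewrite finite_setU; split; first exact: finite_set1.
  by do 2!(apply: bigcup_finite => // ? _).
(* An admissible point if there is one; existence is only established below, at the stages [d i]. *)
have /choice[next nextP] : forall kf : G * (G -> G), exists u,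
    (exists u, forall j, lt j kf.1 -> ~ bad kf.1 u j (kf.2 j)) ->
    forall j, lt j kf.1 -> ~ bad kf.1 u j (kf.2 j).
  move=> [k f]; have [[u uP]|nu] := pselect (exists u, forall j, lt j k -> ~ bad k u j (f j)).
    by exists u.
  by exists k => /nu.
pose step k (rec : forall j, lt j k -> G) : G :=
  next (k, fun j => if pselect (lt j k) is left h then rec j h else j).
pose y := Fix wf (fun=> G) step.
have yE k : y k = step k (fun j _ => y j).
  rewrite /y Fix_eq// => {}k f f' ff'; congr step.
  by apply: functional_extensionality_dep => j; apply: functional_extensionality_dep.
have yP i j : lt j (d i) -> ~ bad (d i) (y (d i)) j (y j).
  move: j; rewrite {1}yE /step.
  set f := (fun j => _); have fE j : lt j (d i) -> f j = y j.
    by rewrite /f; case: pselect.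
  move=> j ji; rewrite -fE//; apply: (nextP (d i, f)) => //=.
  (* Were every point excluded, the finite sets of bad points indexed by the segment would cover
     $G$, so $G$ would inject into the segment. *)
  apply: contrapT => /forallNP cov; apply: (minG (p (c i.1) (c i.2))).
  apply: (@finite_cover_injects _ _ (fun j => [set u | bad (d i) u j (f j)])) => // u _.
  have /existsNP[l /not_implyP[li /contrapT bl]] := cov u.
  by exists l.
have yd i j : lt (d j) (d i) -> y (d i) <> y (d j) /\
    forall g g', g \in i.2 -> g' \in j.2 -> (g * y (d i))%g <> (g' * y (d j))%g.
  move=> ji; have nb := yP _ _ ji; split=> [E|g g' gi gj E]; apply: nb; first by left.
  by right; exists g, g'; rewrite (KE _ i erefl) (KE _ j erefl).
exists (y \o d) => [i j /= E|i j g g' gi gj /= E]; apply: contrapT => ij;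
  (have /tri[lij|lji] : d i <> d j by move=> /d_inj).
- by have [+ _] := yd _ _ lij; apply.
- by have [+ _] := yd _ _ lji; apply.
- by have [_ /(_ _ _ gj gi)] := yd _ _ lij; apply.
- by have [_ /(_ _ _ gi gj)] := yd _ _ lji; apply.
Qed.

(** * Ultralimits of characters *)

Lemma cvg_normcP (R : realType) (I : Type) (W : set_system I) (u : I -> R[i]^o)
    (l : R[i]^o) {FW : Filter W} :
  (u @ W --> l) <-> forall r : R, 0 < r -> \forall j \near W, normc (l - u j) < r.
Proof.
split=> [/cvgrPdist_lt ul r r0|ul].
  have := ul r%:C%C; rewrite ltcR => /(_ r0); apply: filterS => j.
  by rewrite normcEC ltcR.
apply/cvgrPdist_lt => -[a b] /=; rewrite ltcE/= => /andP[/eqP -> a0].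
by apply: filterS (ul a a0) => j; rewrite normcEC ltcR.
Qed.

Lemma cvg_normc_le (R : realType) (I : Type) (W : set_system I) (u : I -> R[i]^o)
    (l : R[i]^o) (M : R) {FW : ProperFilter W} :
  u @ W --> l -> (forall j, normc (u j) <= M) -> normc l <= M.
Proof.
move=> /cvg_normcP ul uM; apply/ler_addgt0Pr => r r0.
have [j lj] := filter_ex (ul r r0).
rewrite -[l](subrK (u j)) (le_trans (normcD _ _))// addrC.
by rewrite lerD// ltW.
Qed.

(** Compactness of a segment gives a cluster point, and an ultrafilter converges to each of its
    cluster points. *)
Lemma ultra_bounded_cvg_real (R : realType) (I : Type) (W : set_system I)
    (u : I -> R) (M : R) : UltraFilter W -> (forall j, `|u j| <= M) ->
  exists l : R, u @ W --> l.
Proof.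
move=> UW uM.
have [|l [_ cl]] := @segment_compact R (- M) M (u @ W) (fmap_proper_filter _ _).
  by apply: (@filterE _ W) => j /=; rewrite in_itv/= -ler_norml.
exists l => B lB; have [//|nB] := @in_ultra_setVsetC _ W (u @^-1` B) UW.
by have [y []] := cl (~` B) B nB lB.
Qed.

Lemma ultra_bounded_cvg (R : realType) (I : Type) (W : set_system I)
    (u : I -> R[i]^o) (M : R) : UltraFilter W -> (forall j, normc (u j) <= M) ->
  exists l : R[i]^o, u @ W --> l.
Proof.
move=> UW uM.
have [|a /cvgrPdist_lt aP] := @ultra_bounded_cvg_real R I W (fun j => complex.Re (u j)) M UW.
  by move=> j; exact: le_trans (Re_le_normc _) (uM j).
have [|b /cvgrPdist_lt bP] := @ultra_bounded_cvg_real R I W (fun j => complex.Im (u j)) M UW.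
  by move=> j; exact: le_trans (Im_le_normc _) (uM j).
exists (a +i* b)%C; apply/cvg_normcP => r r0.
have r2 : 0 < r / 2 by rewrite divr_gt0.
near=> j.
have -> : ((a +i* b)%C - u j : R[i]) =
    (a - complex.Re (u j))%:C%C + (0 +i* (b - complex.Im (u j)))%C.
  by case: (u j) => x y; rewrite /= /GRing.add/= /GRing.opp/= addr0 add0r.
rewrite (le_lt_trans (normcD _ _))// [ltRHS]splitr /= !expr0n/= add0r addr0 !sqrtr_sqr.
by apply: ltrD; near: j; [exact: aP|exact: bP].
Unshelve. all: by end_near. Qed.

Lemma cvg_eventually_eq (R : realType) (I : Type) (W : set_system I)
    (u : I -> R[i]^o) (l c : R[i]^o) {FW : ProperFilter W} :
  u @ W --> l -> (\forall j \near W, u j = c) -> l = c.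
Proof.
move=> ul uc; apply: (@cvg_unique _ (@norm_hausdorff _ _) _ _ _ _ ul).
exact: cvg_near_cst.
Qed.

(** Banach-Alaoglu in pointwise form: the uniform bound makes every limit exist, and linearity and
    the bound pass to the limit. *)
Lemma ultralimit (R : realType) (G : choiceType) (I : Type) (W : set_system I)
    (Phi_ : I -> normed_dual (ellinfty R G)) (M : R) : UltraFilter W -> 0 <= M ->
  (forall j S, normc (Phi_ j S) <= M * normoo S) ->
  exists Phi : normed_dual (ellinfty R G),
    forall S, (fun j => Phi_ j S) @ W --> (Phi S : R[i]^o).
Proof.
move=> UW M0 PhiM.
have /choice[f fP] : forall S, exists l : R[i]^o, (fun j => Phi_ j S) @ W --> l.
  by move=> S; apply: (@ultra_bounded_cvg R I W _ (M * normoo S)) => j; exact: PhiM.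
have lf : linear (f : ellinfty R G -> R[i]^o).
  move=> c S T; apply: (@cvg_unique _ (@norm_hausdorff _ _) _ _ _ _ (fP _)).
  rewrite (_ : (fun j => _) = (fun j => c *: (Phi_ j S : R[i]^o) + Phi_ j T)).
    by apply: cvgD (fP T); apply: cvgZr; exact: fP.
  by apply/funext => j; exact: dual_linear.
have bf : exists2 r : R[i], 0 <= r & forall S, `|f S| <= r * `|S|.
  exists M%:C%C => [|S]; first by rewrite ler0c.
  rewrite ellinfty_normE -rmorphM le_normcC.
  by apply: (cvg_normc_le (fP S)) => j; exact: PhiM.
by exists (dual_of lf bf).
Qed.

(** * Truncations, indicators and characters of $\ell^\infty(G)$ *)

Lemma const_bounded (R : realType) (G : choiceType) (c : R[i]^o) :
  bounded_fun (fun _ : G => c).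
Proof. by apply/bounded_fun_normcP; exists (normc c). Qed.

Definition ellinfty_one (R : realType) (G : choiceType) : ellinfty R G :=
  ellinfty_of (const_bounded G 1).

Lemma truncation_bounded (R : realType) (G : choiceType) (F : seq G) (S : ellinfty R G) :
  bounded_fun (fun g => (g \in F)%:R * S g : R[i]^o).
Proof.
apply/bounded_fun_normcP; exists (normoo S) => g.
by case: (g \in F); rewrite ?mul1r ?normc_le_normoo// mul0r Normc.normc0 normoo_ge0.
Qed.

Definition truncation (R : realType) (G : choiceType) (F : seq G) (S : ellinfty R G) :
  ellinfty R G := ellinfty_of (truncation_bounded F S).

Definition indicator1 (R : realType) (G : choiceType) (g : G) : ellinfty R G :=
  truncation [:: g] (ellinfty_one R G).

Lemma truncationE (R : realType) (G : choiceType) (F : seq G) (S : ellinfty R G) g :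
  truncation F S g = (g \in F)%:R * S g.
Proof. by []. Qed.

Lemma normoo_truncation (R : realType) (G : choiceType) (F : seq G) (S : ellinfty R G) :
  normoo (truncation F S) <= normoo S.
Proof.
apply: normoo_le => [|g]; first exact: normoo_ge0.
by rewrite truncationE; case: (g \in F);
  rewrite ?mul1r ?normc_le_normoo// mul0r Normc.normc0 normoo_ge0.
Qed.

Lemma indicator1E (R : realType) (G : choiceType) (g h : G) :
  indicator1 R g h = (h == g)%:R.
Proof. by rewrite truncationE inE mulr1. Qed.

Lemma c_zero_indicator1 (R : realType) (G : choiceType) (g : G) : c_zero (indicator1 R g).
Proof.
move=> e e0; apply: sub_finite_set (finite_set1 g) => h.
rewrite /mkset indicator1E; case: eqVneq => //= _.
by rewrite expr0n addr0 sqrtr0 leNgt e0.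
Qed.

(** A truncation is a finite combination of indicators; a repeated entry of [F] would be counted
    twice in the sum. *)
Lemma dual_truncation (R : realType) (G : choiceType) (Psi : normed_dual (ellinfty R G))
    (F : seq G) (S : ellinfty R G) :
  uniq F -> Psi (truncation F S) = \sum_(g <- F) S g * Psi (indicator1 R g).
Proof.
elim: F => [_|g F IHF /= /andP[gF uF]].
  rewrite big_nil -[RHS](linear0 Psi); congr (Psi _).
  by apply/val_inj/funext => h; rewrite /= mul0r.
rewrite big_cons -IHF// -[_ * _]/(_ *: _) -dual_linear; congr (Psi _).
apply/val_inj/funext => h /=.
rewrite -[RHS]/(S g * indicator1 R g h + truncation F S h) indicator1E truncationE inE.
have [->|] /= := eqVneq h g; last by rewrite mulr0 add0r.
by rewrite (negPf gF) mul0r addr0 mul1r mulr1.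
Qed.

(** All three clauses survive pointwise limits: the norm bound makes ultralimits exist, and the
    value at [ellinfty_one] keeps them nonzero. *)
Definition character (R : realType) (G : choiceType) (Phi : normed_dual (ellinfty R G)) :=
  [/\ Phi (ellinfty_one R G) = 1,
      forall S T, Phi (ellinfty_mul S T) = Phi S * Phi T &
      forall S, normc (Phi S) <= normoo S].

(** One test class for all four centres: such functionals lie in $c_0(G)^\perp$ and in $G^*$. *)
Definition free_character (R : realType) (G : choiceType)
    (Phi : normed_dual (ellinfty R G)) :=
  character Phi /\ forall S, c_zero S -> Phi S = 0.

Lemma character_lim (R : realType) (G : choiceType) (I : Type) (W : set_system I)
    (Phi_ : I -> normed_dual (ellinfty R G)) (Phi : normed_dual (ellinfty R G))
    {FW : ProperFilter W} :
  (forall j, character (Phi_ j)) ->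
  (forall S, (fun j => Phi_ j S) @ W --> (Phi S : R[i]^o)) -> character Phi.
Proof.
move=> cPhi PhiP; split=> [|S T|S].
- by apply: (cvg_eventually_eq (PhiP _)); apply: nearW => j; have [] := cPhi j.
- apply: (@cvg_unique _ (@norm_hausdorff _ _) _ _ _ _ (PhiP _)).
  rewrite (_ : (fun j => _) = (fun j => (Phi_ j S : R[i]^o) * Phi_ j T)).
    by apply: cvgM; exact: PhiP.
  by apply/funext => j; have [_ + _] := cPhi j; apply.
- by apply: (cvg_normc_le (PhiP S)) => j; have [_ _] := cPhi j; apply.
Qed.

Lemma character_ultralimit (R : realType) (G : choiceType) (I : Type) (W : set_system I)
    (Phi_ : I -> normed_dual (ellinfty R G)) :
  UltraFilter W -> (forall j, character (Phi_ j)) ->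
  exists2 Phi : normed_dual (ellinfty R G), character Phi &
    forall S, (fun j => Phi_ j S) @ W --> (Phi S : R[i]^o).
Proof.
move=> UW cPhi; have [|j S|Phi PhiP] := @ultralimit R G I W Phi_ 1 UW; first exact: ler01.
  by rewrite mul1r; have [_ _] := cPhi j; apply.
by exists Phi => //; exact: character_lim PhiP.
Qed.

Lemma character_point_evaluation (R : realType) (G : semigroupType) (g : G) :
  character (point_evaluation R g).
Proof. by split=> // S; exact: normc_le_normoo. Qed.

(** The finite subsets of [T] directed by inclusion, represented by lists in which order and
    repetitions are allowed. *)
Definition tails (T : choiceType) : set_system (seq T) :=
  filter_from [set: seq T] (fun s => [set s' : seq T | {subset s <= s'}]).
Arguments tails : clear implicits.

#[local] Instance tails_proper (T : choiceType) : ProperFilter (tails T).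
Proof.
apply: filter_from_proper => [|s _]; last by exists s.
apply: filter_fromT_filter; first by exists [::].
move=> s t; exists (s ++ t) => u su; split=> x xs; apply: su;
  by rewrite mem_cat xs ?orbT.
Qed.

Lemma tails_mem (T : choiceType) (g : T) : tails T [set s : seq T | g \in s].
Proof. by exists [:: g] => // s gs; apply: gs; rewrite inE. Qed.

(** Only finitely many lists are sent into [Z]; any list with an entry [g] outside all of them is
    sent elsewhere. *)
Lemma tails_avoid (T U : choiceType) (x : seq T -> U) (Z : set U) :
  infinite_set [set: T] -> injective x -> finite_set Z ->
  tails T [set K : seq T | ~ Z (x K)].
Proof.
move=> infT x_inj finZ.
have /finite_seqP[L LE] : finite_set (x @^-1` Z).
  by apply: finite_preimage => // ? ? _ _; exact: x_inj.
have [g gL] : exists g, g \notin flatten L.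
  apply: contrapT => /forallNP nL; apply: infT; apply/finite_seqP.
  exists (flatten L); apply/seteqP; split=> // g _ /=.
  by have /negP/negPn := nL g.
exists [:: g] => // K gK ZxK; case/negP: gL.
apply/flattenP; exists K; last by apply: gK; rewrite inE.
by have : (x @^-1` Z) K by []; rewrite LE.
Qed.

(** * The factorization and the centres *)

Lemma ellinfty_act_dirac (R : realType) (G : semigroupType) (S : ellinfty R G) (g h : G) :
  ellinfty_act S (dirac1 R g) h = S (g * h)%g.
Proof. by rewrite -pairing_dirac ellinfty_actE convolution_dirac pairing_dirac. Qed.

Lemma bidual_act_dirac (R : realType) (G : semigroupType)
    (Phi : normed_dual (ellinfty R G)) (S : ellinfty R G) (g : G) :
  bidual_act Phi S g = Phi (ellinfty_act S (dirac1 R g)).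
Proof. by rewrite -pairing_dirac bidual_actE. Qed.

(** The prescriptions are consistent: a point $y=gx_{F,K}$ with $g\in K$ determines $(F,K)$ by
    disjointness, and then $g$ by right cancellation. All values can be bounded by
    $\|f\|_\infty$. *)
Lemma prescribed_translates (R : realType) (G : semigroupType) (f : ellinfty R G) :
  infinite_set [set: G] -> weakly_cancellative G -> right_cancellative G ->
  exists2 x : seq G * seq G -> G, injective x &
  exists S : ellinfty R G, forall F K g, g \in K ->
    S (g * x (F, K))%g = truncation F f g.
Proof.
move=> infG wcG rcG.
have [|x x_inj disj] := @disjoint_translates G infG; first by move=> s t; have [] := wcG s t.
exists x => //.
have /choice[S SP] : forall y, exists z : R[i]^o, normc z <= normoo f /\
    forall F K g, g \in K -> y = (g * x (F, K))%g -> z = truncation F f g.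
  move=> y; have [[F [K [g [gK ->]]]]|ny] := pselect (exists F K g,
    g \in K /\ y = (g * x (F, K))%g); last first.
    exists 0; split; first by rewrite Normc.normc0 normoo_ge0.
    by move=> F K g gK yE; case: ny; exists F, K, g.
  exists (truncation F f g); split.
    exact: le_trans (normc_le_normoo _ _) (normoo_truncation F f).
  move=> F' K' g' gK' E; have := disj (F, K) (F', K') g g' gK gK' E.
  move=> FK; rewrite -FK in E; case: FK => -> _; congr (truncation _ _ _).
  exact: rcG E erefl.
have bS : bounded_fun S by apply/bounded_fun_normcP; exists (normoo f) => y; have [] := SP y.
exists (ellinfty_of bS) => F K g gK /=.
by have [_ E] := SP (g * x (F, K))%g; exact: E gK erefl.
Qed.

Lemma truncation_factorization (R : realType) (G : semigroupType) (f : ellinfty R G) :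
  infinite_set [set: G] -> weakly_cancellative G -> right_cancellative G ->
  exists (S : ellinfty R G) (W : set_system (seq G))
      (Phi_ : seq G -> normed_dual (ellinfty R G)) (Phi : normed_dual (ellinfty R G)),
    [/\ ProperFilter W, (forall F, free_character (Phi_ F)) /\ free_character Phi,
        forall T, (fun F => Phi_ F T) @ W --> (Phi T : R[i]^o),
        forall F, bidual_act (Phi_ F) S = truncation F f &
        bidual_act Phi S = f].
Proof.
move=> infG wcG rcG; have [x x_inj [S SE]] := prescribed_translates f infG wcG rcG.
(* One ultrafilter refining the tails serves for the limit in $K$ and for the later limit in $F$. *)
have [W [UW tW]] := ultraFilterLemma (tails_proper G).
have /choice[Phi_ PhiP] : forall F, exists Phi : normed_dual (ellinfty R G),
    character Phi /\ forall T : ellinfty R G, (fun K => T (x (F, K))) @ W --> (Phi T : R[i]^o).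
  move=> F; have [|Phi cPhi PhiP] := @character_ultralimit R G _ W
    (fun K => point_evaluation R (x (F, K))) UW; last by exists Phi.
  by move=> K; exact: character_point_evaluation.
(* For fixed $F$ the points $x_{F,K}$ eventually leave every finite set, so $T(x_{F,K})\to0$ for
   $T\in c_0(G)$. *)
have fPhi F : free_character (Phi_ F).
  have [cPhi lPhi] := PhiP F; split=> // T T0.
  apply: (@cvg_unique _ (@norm_hausdorff _ _) _ _ _ _ (lPhi T)).
  apply/cvg_normcP => r r0; apply: tW.
  have : tails G [set K : seq G | ~ [set g | r <= normc (T g)] (x (F, K))].
    by apply: tails_avoid (T0 r r0) => // K K' /x_inj[].
  by apply: filterS => K /= /negP; rewrite -ltNge add0r normcN.
(* At $g$ the left side is $\lim_K S(gx_{F,K})$, which is constant as soon as $g\in K$. *)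
have PhiE F : bidual_act (Phi_ F) S = truncation F f.
  apply/val_inj/funext => g; rewrite [LHS]bidual_act_dirac.
  have [_ lPhi] := PhiP F; apply: (cvg_eventually_eq (lPhi _)).
  apply: filterS (tW _ (tails_mem g)) => K gK.
  by rewrite ellinfty_act_dirac SE.
have [Phi cPhi lPhi] := character_ultralimit UW (fun F => (fPhi F).1).
exists S, W, Phi_, Phi.
split=> [||//|//|]; first exact: ultra_proper.
  split; first exact: fPhi.
  split=> // T T0; apply: (cvg_eventually_eq (lPhi T)).
  by apply: nearW => F; have [_] := fPhi F; apply.
apply/val_inj/funext => g; rewrite [LHS]bidual_act_dirac.
apply: (cvg_eventually_eq (lPhi _)).
apply: filterS (tW _ (tails_mem g)) => F gF.
by rewrite -bidual_act_dirac PhiE truncationE gF mul1r.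
Qed.

(* Continuity is only asked along the nets produced by [truncation_factorization]; unlike
   membership in a centre, this is stable under differences. *)
Definition free_continuous (R : realType) (G : semigroupType)
    (Psi : normed_dual (ellinfty R G)) : Prop :=
  forall (W : set_system (seq G)) (Phi_ : seq G -> normed_dual (ellinfty R G))
      (Phi : normed_dual (ellinfty R G)) (S : ellinfty R G), ProperFilter W ->
    (forall F, free_character (Phi_ F)) -> free_character Phi ->
    (forall T, (fun F => Phi_ F T) @ W --> (Phi T : R[i]^o)) ->
    (fun F => Psi (bidual_act (Phi_ F) S)) @ W --> (Psi (bidual_act Phi S) : R[i]^o).

Lemma centre_free_continuous (R : realType) (G : semigroupType)
    (X : set (normed_dual (ellinfty R G))) (Psi : normed_dual (ellinfty R G)) :
  (forall Phi, free_character Phi -> X Phi) ->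
  first_topological_centre X Psi -> free_continuous Psi.
Proof.
move=> QX [_ /subspace_continuousP cPsi] W Phi_ Phi S FW fPhi_ fPhi PhiP.
have lim : (fun F => arens_product Psi (Phi_ F)) @ W --> arens_product Psi Phi.
  have lPhi := (@weak_star_cvgP R[i] (ellinfty R G) (Phi_ @ W) Phi _).2 PhiP.
  move=> B /(cPsi Phi (QX _ fPhi)) /lPhi; apply: (@filterS _ W) => F; apply; exact: QX.
exact: ((weak_star_cvgP _ _).1 lim S).
Qed.

(** For $a\in\ell^1(G)$ one has $\langle a\Phi,S\rangle=\langle\Phi,S\cdot a\rangle$, an evaluation
    of $\Phi$. *)
Lemma arens_product_ell1_continuous (R : realType) (G : semigroupType) (a : ell1 R G) :
  continuous (arens_product (ell1_to_bidual a)).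
Proof.
move=> Phi.
apply: (@weak_star_cvgP R[i] (ellinfty R G) (arens_product _ @ Phi) _
  (fmap_filter _ (nbhs_filter Phi))).2 => S.
have E Phi' : arens_product (ell1_to_bidual a) Phi' S = Phi' (ellinfty_act S a).
  by rewrite arens_productE -bidual_actE.
rewrite E -[X in X --> _]/((fun Phi' => arens_product (ell1_to_bidual a) Phi' S) @ Phi).
rewrite (funext E).
exact: ((@weak_star_cvgP R[i] (ellinfty R G) (nbhs Phi) Phi _).1 cvg_id).
Qed.

Lemma free_continuous_eq0 (R : realType) (G : semigroupType)
    (Psi : normed_dual (ellinfty R G)) :
  infinite_set [set: G] -> weakly_cancellative G -> right_cancellative G ->
  free_continuous Psi -> (forall g, Psi (indicator1 R g) = 0) -> Psi = 0.
Proof.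
move=> infG wcG rcG cPsi Psi0; apply/val_inj/funext => f.
have [S [W [Phi_ [Phi [FW [fPhi_ fPhi] PhiP PhiE <-]]]]] :=
  truncation_factorization f infG wcG rcG.
apply: (cvg_eventually_eq (cPsi W Phi_ Phi S FW fPhi_ fPhi PhiP)).
(* Removing repetitions leaves the truncation unchanged and makes it a sum over distinct points. *)
apply: nearW => F; rewrite PhiE (_ : truncation F f = truncation (undup F) f).
  by rewrite dual_truncation ?undup_uniq// big1// => g _; rewrite Psi0 mulr0.
by apply/val_inj/funext => g; rewrite /= mem_undup.
Qed.

(** * Characters in $\beta G$ and point masses of functionals *)

Lemma character_betaG (R : realType) (G : semigroupType)
    (Phi : normed_dual (ellinfty R G)) :
  character Phi -> betaG Phi.
Proof.
move=> [Phi1 mPhi _]; split=> // Phi0.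
by have := oner_neq0 R[i]; rewrite -Phi1 Phi0 eqxx.
Qed.

Lemma free_character_remainder (R : realType) (G : semigroupType)
    (Phi : normed_dual (ellinfty R G)) :
  free_character Phi -> betaG_remainder Phi.
Proof.
move=> [cPhi Phi0]; split; first exact: character_betaG.
move=> [g _ gPhi]; have := Phi0 _ (@c_zero_indicator1 R G g).
by rewrite -gPhi -[LHS]/(indicator1 R g g) indicator1E eqxx => /eqP; rewrite oner_eq0.
Qed.

(** Apply $\Psi$ to $S1_{\{g\}}=S(g)1_{\{g\}}$ and cancel $\Psi(1_{\{g\}})$. *)
Lemma betaG_indicator1 (R : realType) (G : semigroupType)
    (Psi : normed_dual (ellinfty R G)) (g : G) :
  betaG Psi -> Psi (indicator1 R g) <> 0 -> Psi = point_evaluation R g.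
Proof.
move=> [_ mPsi] /eqP Psig; apply/val_inj/funext => S.
apply: (mulIf Psig); rewrite -[Psi S * _]mPsi.
rewrite (_ : ellinfty_mul S _ = S g *: indicator1 R g) ?linearZ//.
apply/val_inj/funext => h.
rewrite -[LHS]/(S h * indicator1 R g h) -[RHS]/(S g * indicator1 R g h) indicator1E.
by case: eqVneq => [->|]; rewrite ?mulr0.
Qed.

(** Testing $\Psi$ on finite truncations of a function of modulus at most 1 that aligns the phases
    bounds every finite sum of $|\Psi(1_{\{g\}})|$ by the same constant. *)
Lemma masses_summable (R : realType) (G : choiceType)
    (Psi : normed_dual (ellinfty R G)) :
  abs_summable (fun g => Psi (indicator1 R g) : R[i]^o).
Proof.
have [r r0 rPsi] := dual_bounded Psi.
(* Where $\Psi(1_{\{g\}})=0$ the quotient is 0 by convention, and [phE] still holds. *)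
pose ph g : R[i]^o := `|Psi (indicator1 R g)| / Psi (indicator1 R g).
have phE g : ph g * Psi (indicator1 R g) = `|Psi (indicator1 R g)|.
  rewrite /ph; have [->|nz] := eqVneq (Psi (indicator1 R g)) 0.
    by rewrite mulr0 normr0.
  by rewrite mulfVK.
have ph1 g : normc (ph g) <= 1.
  rewrite -le_normcC /ph normrM normr_id normfV.
  have [->|nz] := eqVneq (Psi (indicator1 R g)) 0; first by rewrite normr0 mul0r.
  by rewrite mulfV ?normr_eq0.
have bph : bounded_fun ph by apply/bounded_fun_normcP; exists 1.
pose S := ellinfty_of bph.
have S1 F : normoo (truncation F S) <= 1.
  by rewrite (le_trans (normoo_truncation _ _))// normoo_le.
apply: (@le_lt_trans _ _ (complex.Re r)%:E); last exact: ltry.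
apply: ge_ereal_sup => _ [X [finX _] <-].
rewrite fsbig_finite// sumEFin lee_fin.
have sumE : (\sum_(g <- fset_set X) normc (Psi (indicator1 R g)))%:C%C =
    Psi (truncation (fset_set X) S).
  rewrite dual_truncation ?fset_uniq// rmorph_sum; apply: eq_bigr => g _.
  by rewrite /= -normcEC -phE.
have := rPsi (truncation (fset_set X) S); rewrite -sumE.
rewrite (ger0_norm (x := _%:C%C)); last first.
  by rewrite ler0c sumr_ge0// => g _; exact: normc_ge0.
have S1C : `|truncation (fset_set X) S| <= 1 by rewrite ellinfty_normE lecR.
move=> /le_trans/(_ (ler_wpM2l r0 S1C)); rewrite mulr1.
by case: (r) => x y; rewrite lecE => /andP[].
Qed.

Definition masses (R : realType) (G : choiceType) (Psi : normed_dual (ellinfty R G)) :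
  ell1 R G := ell1_of (masses_summable Psi).

Lemma masses_indicator1 (R : realType) (G : choiceType)
    (Psi : normed_dual (ellinfty R G)) (g : G) :
  ell1_to_bidual (masses Psi) (indicator1 R g) = Psi (indicator1 R g).
Proof.
rewrite -[LHS]/(csum _) (@csum_supp1 _ _ _ g) => [|h /negPf hg];
  by rewrite indicator1E ?eqxx ?mul1r// hg mul0r.
Qed.

Lemma ell1_to_bidual_dirac (R : realType) (G : semigroupType) (g : G) :
  ell1_to_bidual (dirac1 R g) = point_evaluation R g.
Proof. by apply/val_inj/funext => S; exact: pairing_dirac. Qed.

Lemma ell1_to_bidual_centre (R : realType) (G : semigroupType)
    (X : set (normed_dual (ellinfty R G))) (a : ell1 R G) :
  X (ell1_to_bidual a) -> first_topological_centre X (ell1_to_bidual a).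
Proof.
move=> Xa; split=> //; apply: continuous_subspaceT.
exact: arens_product_ell1_continuous.
Qed.

Lemma free_continuousB (R : realType) (G : semigroupType)
    (Psi Psi' : normed_dual (ellinfty R G)) :
  free_continuous Psi -> free_continuous Psi' -> free_continuous (Psi - Psi').
Proof.
move=> cPsi cPsi' W Phi_ Phi S FW fPhi_ fPhi PhiP.
exact: cvgB (cPsi _ _ _ S FW fPhi_ fPhi PhiP) (cPsi' _ _ _ S FW fPhi_ fPhi PhiP).
Qed.

Theorem theorem6p9 (R : realType) (G : semigroupType)
    (infG : infinite_set [set: G])
    (wcG : weakly_cancellative G) (rcG : right_cancellative G) :
  [/\ first_topological_centre [set: normed_dual (ellinfty R G)]
        = range (@ell1_to_bidual R G),
      first_topological_centre (@c_zero_perp R G) = [set 0],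
      first_topological_centre (@betaG R G) = range (@point_evaluation R G)
    & first_topological_centre (@betaG_remainder R G) = set0].
Proof.
have eq0 (X : set (normed_dual (ellinfty R G))) Psi : (forall Phi, free_character Phi -> X Phi) ->
    first_topological_centre X Psi ->
    (forall g, Psi (indicator1 R g) = 0) -> Psi = 0.
  by move=> QX cPsi; apply: free_continuous_eq0 => //; exact: centre_free_continuous QX cPsi.
have free_beta (Phi : normed_dual (ellinfty R G)) : free_character Phi -> betaG Phi.
  by move=> /free_character_remainder[].
have betaN0 (Psi : normed_dual (ellinfty R G)) : betaG Psi -> Psi <> 0.
  by move=> [Psi0 _] Psi00; apply: Psi0; rewrite Psi00.
split; apply/seteqP; split=> // Psi.
(* The difference of $\Psi$ and its $\ell^1$ part is continuous along the test nets and vanishes on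
   all indicators. *)
- move=> cPsi; exists (masses Psi) => //; apply/esym/subr0_eq.
  apply: free_continuous_eq0 => // [|g].
    apply: free_continuousB; first exact: (@centre_free_continuous _ _ setT _ _ cPsi).
    by apply: (@centre_free_continuous _ _ setT) => //; exact: ell1_to_bidual_centre.
  by rewrite -[LHS]/(Psi _ - ell1_to_bidual _ _) masses_indicator1 subrr.
- by move=> [a _ <-]; exact: ell1_to_bidual_centre.
- move=> cPsi; apply: (eq0 _ _ _ cPsi) => [Phi []//|g].
  by have [+ _] := cPsi; apply; exact: c_zero_indicator1.
- move=> ->; have pair0 S : pairing S (0 : ell1 R G) = 0 := linear0 (ellinfty_to_dual S).
  have <- : ell1_to_bidual (0 : ell1 R G) = 0 by apply/val_inj/funext => S; exact: pair0.
  by apply: ell1_to_bidual_centre => S _; exact: pair0.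
- move=> cPsi; have [bPsi _] := cPsi.
  (* Either $\Psi$ charges a point and is evaluation there, or it vanishes on all indicators and
     would be 0. *)
  have [[g /(betaG_indicator1 bPsi) ->]|Psi0] := pselect (exists g, Psi (indicator1 R g) <> 0).
    by exists g.
  case: (betaN0 _ bPsi); apply: (eq0 _ _ free_beta cPsi) => g.
  by apply: contrapT => ng; apply: Psi0; exists g.
- move=> [g _ <-]; rewrite -ell1_to_bidual_dirac; apply: ell1_to_bidual_centre.
  by rewrite ell1_to_bidual_dirac; exact/character_betaG/character_point_evaluation.
- move=> cPsi; have [[bPsi nPsi] _] := cPsi.
  apply: (betaN0 _ bPsi); apply: (eq0 _ _ (@free_character_remainder R G) cPsi) => g.
  by apply: contrapT => /(betaG_indicator1 bPsi) PsiE; apply: nPsi; exists g.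
Qed.
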